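(* Let $m\in\mathbb N$ and let $\mathcal L=\sum_{|\gamma|=m}a_\gamma\partial^\gamma$ (with $a_\gamma\in\mathbb C$) be an elliptic operator of anisotropic order $m$ on $\mathbb R^d$. Suppose $0<\alpha<\eta<m$ with $\alpha,\eta\notin\mathbb N$. There exists a constant $C$ such that for all germs $U$ over $\mathbb R^d$ with $\|U\|_{G^\eta(\mathbb R^d)}<\infty$ it holds $$\|U\|_{G^\eta(\mathbb R^d)}\le C\big([\mathcal LU]_{G^{\eta-m}(\mathbb R^d)}+[U]_{G^{\eta,\alpha}(\mathbb R^d)}\big).$$
   Context: Fix a scaling $\mathfrak s\in\mathbb N^d$; for $\beta\in\mathbb N_0^d$, $|\beta|:=\sum_i\mathfrak s_i\beta_i$. The anisotropic distance is $d(x,y):=\sum_{i}|x_i-y_i|^{1/\mathfrak s_i}$, $B_R(x)$ the open ball for $d$, and $\mathcal P_k$ the polynomials $\sum_{|\beta|\le k}c_\beta z^\beta$. $\mathcal L$ is elliptic if for every open $D\subseteq\mathbb R^d$ and $u\in\mathcal D'(D)$, $\mathcal Lu\in C^\infty(D)$ implies $u\in C^\infty(D)$. A germ over $D$ is a family $U=(U_x)_{x\in D}$ of continuous $U_x:D\to\mathbb C$. $\|U\|_{G^\eta(D)}$ is the infimum of all $M>0$ with $|U_x(y)|\le M\,d(x,y)^\eta$ for all $x,y\in D$; $[U]_{G^{\eta,\alpha}(D)}$ is the infimum of all $M>0$ such that for all $x,y\in D$ there is $P\in\mathcal P_{\lfloor\eta\rfloor}$ with $|(U_x-U_y-P)(z)|\le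 M\,d(y,z)^\alpha(d(x,y)+d(y,z))^{\eta-\alpha}$ for all $z\in D$. For $\gamma<0$, with $k:=\lceil|\gamma|\rceil$, $\mathcal B$ is the set of $\varphi\in C_c^\infty(\mathbb R^d)$ supported in $B_1(0)$ with $\sup_{|\beta|\le k}\sup|\partial^\beta\varphi|\le 1$, and $\varphi_x^\lambda(y):=\lambda^{-\sum_i\mathfrak s_i}\varphi(\lambda^{-\mathfrak s_1}(y_1-x_1),\dots,\lambda^{-\mathfrak s_d}(y_d-x_d))$. For open $D$ and $V=(V_x)_{x\in D}$, $V_x\in\mathcal D'(D)$, $[V]_{G^\gamma(D)}:=\sup_{\varphi\in\mathcal B}\sup_{x\in D}\sup_{\lambda>0,\,B_\lambda(x)\subseteq D}\lambda^{-\gamma}|\langle V_x,\varphi_x^\lambda\rangle|$. $\mathcal LU:=(\mathcal LU_x)_x$, $\mathcal L$ acting distributionally in the active variable. *)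

(* Defs.v *)
From HB Require Import structures.
From mathcomp Require Import all_boot all_order all_algebra.
From mathcomp Require Import all_classical all_reals all_analysis.
From mathcomp Require Import complex.

Set Implicit Arguments.
Unset Strict Implicit.
Unset Printing Implicit Defensive.

Import Order.TTheory GRing.Theory Num.Theory.
Import numFieldNormedType.Exports.

Local Open Scope classical_set_scope.
Local Open Scope ring_scope.
Local Open Scope complex_scope.

Section AnisoDefs.
Variables (R : realType) (d : nat).
Notation pt := 'rV[R]_d.
Notation C := R[i].

Definition sdeg (s : 'I_d -> nat) (b : 'I_d -> nat) : nat := (\sum_i s i * b i)%N.

Definition adist (s : 'I_d -> nat) (x y : pt) : R :=
  \sum_i (`|x 0 i - y 0 i| `^ ((s i)%:R)^-1).

Definition cabs (z : C) : R := Normc.normc z.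

Definition evec (i : 'I_d) : pt := \row_j ((i == j)%:R).

Definition pd (i : 'I_d) (f : pt -> R) : pt -> R := fun x => 'D_(evec i) f x.
Definition pdl (l : seq 'I_d) (f : pt -> R) : pt -> R := foldr pd f l.

Definition smoothR (D : set pt) (f : pt -> R) : Prop :=
  forall l : seq 'I_d,
    (forall x, D x -> {for x, continuous (pdl l f)}) /\
    (forall i x, D x -> derivable (pdl l f) x (evec i)).

Definition smoothC (D : set pt) (f : pt -> C) : Prop :=
  smoothR D (fun x => complex.Re (f x)) /\ smoothR D (fun x => complex.Im (f x)).

Definition pdC (i : 'I_d) (f : pt -> C) : pt -> C :=
  fun x => (pd i (fun y => complex.Re (f y)) x +i* pd i (fun y => complex.Im (f y)) x).
Definition pdlC (l : seq 'I_d) (f : pt -> C) : pt -> C := foldr pdC f l.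

Definition dmulti (b : 'I_d -> nat) (f : pt -> C) : pt -> C :=
  foldr (fun i g => iter (b i) (pdC i) g) f (enum 'I_d).

(* Lebesgue integral over R^d, as an iterated integral over the coordinates *)
Definition setc (j : nat) (x : pt) (t : R) : pt :=
  \row_i (if (i : nat) == j then t else x 0 i).

Fixpoint iint_aux (n : nat) (f : pt -> R) (x : pt) : R :=
  match n with
  | 0 => f x
  | n'.+1 => Rintegral (@lebesgue_measure R) setT
               (fun t => iint_aux n' f (setc n' x t))
  end.

Definition integral (f : pt -> R) : R := iint_aux d f 0.

Definition cint (f : pt -> C) : C :=
  (integral (fun y => complex.Re (f y)) +i* integral (fun y => complex.Im (f y))).

Definition testfun (D : set pt) (phi : pt -> C) : Prop :=
  smoothC setT phi /\
  exists K : set pt, [/\ compact K, K `<=` D & forall x, ~ K x -> phi x = 0].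

Definition distribution (D : set pt) (u : (pt -> C) -> C) : Prop :=
  (forall (c : C) phi psi, testfun D phi -> testfun D psi ->
     u (fun x => c * phi x + psi x) = c * u phi + u psi) /\
  (forall K : set pt, compact K -> K `<=` D ->
     exists (Cst : R) (N : nat), forall phi, testfun D phi ->
       (forall x, ~ K x -> phi x = 0) ->
       forall M : R, (forall l : seq 'I_d, (size l <= N)%N ->
                        forall x, cabs (pdlC l phi x) <= M) ->
       cabs (u phi) <= Cst * M).

(* the operator L = sum_{|gamma| = m} a_gamma d^gamma; gamma ranges over
   multi-indices with entries <= m (which contains all |gamma| = m).
   LT is the formal transpose: <L u, phi> = <u, LT phi>. *)
Definition Lop (s : 'I_d -> nat) (m : nat) (a : {ffun 'I_d -> 'I_m.+1} -> C)
  (f : pt -> C) : pt -> C :=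
  fun x => \sum_(b : {ffun 'I_d -> 'I_m.+1} | sdeg s (fun i => b i : nat) == m)
             a b * dmulti (fun i => b i : nat) f x.

Definition LT (s : 'I_d -> nat) (m : nat) (a : {ffun 'I_d -> 'I_m.+1} -> C)
  (phi : pt -> C) : pt -> C :=
  fun x => \sum_(b : {ffun 'I_d -> 'I_m.+1} | sdeg s (fun i => b i : nat) == m)
             a b * (-1) ^+ (\sum_i (b i : nat)) * dmulti (fun i => b i : nat) phi x.

Definition elliptic (s : 'I_d -> nat) (m : nat)
  (a : {ffun 'I_d -> 'I_m.+1} -> C) : Prop :=
  forall D : set pt, open D -> forall u, distribution D u ->
    (exists f, smoothC D f /\
       forall phi, testfun D phi -> u (LT s a phi) = cint (fun y => f y * phi y)) ->
    (exists g, smoothC D g /\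
       forall phi, testfun D phi -> u phi = cint (fun y => g y * phi y)).

Definition germ (U : pt -> pt -> C) : Prop :=
  forall x, continuous (fun y => complex.Re (U x y)) /\ continuous (fun y => complex.Im (U x y)).

Definition Gnorm (s : 'I_d -> nat) (eta : R) (U : pt -> pt -> C) : \bar R :=
  ereal_inf [set (M%:E)%E | M in [set M : R | 0 < M /\
     forall x y, cabs (U x y) <= M * adist s x y `^ eta]].

Definition isPoly (s : 'I_d -> nat) (k : nat) (P : pt -> C) : Prop :=
  exists c : {ffun 'I_d -> 'I_k.+1} -> C, forall z,
    P z = \sum_(b : {ffun 'I_d -> 'I_k.+1} | (sdeg s (fun i => b i : nat) <= k)%N)
            c b * \prod_i ((z 0 i) ^+ (b i : nat))%:C.

(* [U]_{G^{eta,alpha}(R^d)}; floor eta = truncn eta since eta > 0 *)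
Definition Gsemi (s : 'I_d -> nat) (eta alpha : R) (U : pt -> pt -> C) : \bar R :=
  ereal_inf [set (M%:E)%E | M in [set M : R | 0 < M /\
     forall x y, exists P, isPoly s (Num.truncn eta) P /\
       forall z, cabs (U x z - U y z - P z)
                 <= M * adist s y z `^ alpha * (adist s x y + adist s y z) `^ (eta - alpha)]].

(* the class B (for gamma < 0, k = ceil |gamma|) *)
Definition Bclass (s : 'I_d -> nat) (gam : R) (phi : pt -> C) : Prop :=
  [/\ testfun setT phi,
      (forall y, phi y <> 0 -> adist s y 0 < 1) &
      (forall b : 'I_d -> nat, ((sdeg s b)%:~R <= Num.ceil `|gam|)%R ->
         forall y, cabs (dmulti b phi y) <= 1)].

Definition rescale (s : 'I_d -> nat) (phi : pt -> C) (x : pt) (lam : R) : pt -> C :=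
  fun y => (lam ^- (\sum_i s i))%:C *
           phi (\row_i (lam ^- (s i) * (y 0 i - x 0 i))).

(* [L U]_{G^gam(R^d)}, with <L U_x, psi> = int U_x(y) (LT psi)(y) dy;
   the condition B_lambda(x) in R^d is automatic. *)
Definition LGsemi (s : 'I_d -> nat) (m : nat) (a : {ffun 'I_d -> 'I_m.+1} -> C)
  (gam : R) (U : pt -> pt -> C) : \bar R :=
  ereal_sup [set (r%:E)%E | r in [set r : R | exists phi x lam,
     [/\ Bclass s gam phi, 0 < lam &
         r = lam `^ (- gam) *
             cabs (cint (fun y => U x y * LT s a (rescale s phi x lam) y))]]].

End AnisoDefs.

(* Main.v *)
(** Blow-up and Liouville.  If no constant works, there are germs [U_n] of norm
    [N_n] with [[L U_n] + [U_n] <= N_n / n] that nearly attain their norm at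
    some pair [(x_n, y_n)]; rescaling [U_n (x_n)] around [x_n] by
    [lam_n = d(x_n, y_n)] gives functions [V_n] with [|V_n z| <= 2 d(0, z)^eta]
    and [|V_n z| > 1/2] at a point at distance 1 from the origin.  Near every
    point [V_n] is a polynomial of bounded degree up to an error of order
    [alpha], which makes [(V_n)] equicontinuous along coordinate lines; an
    ultrafilter limit [V] is locally uniform, solves [L V = 0] and still
    satisfies [|V z| <= 2 d(0, z)^eta].  Hypoellipticity and the uniform
    boundedness principle bound each derivative of a solution at a point by a
    weighted sup norm.  Rescaling this estimate at any point with
    [lam -> oo] kills all derivatives of anisotropic order [> eta], and at the
    origin with [lam -> 0] those of order [< eta].  Since [eta] is not an
    integer, [V = 0], a contradiction. *)

Require Import Defs.
From HB Require Import structures.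
From mathcomp Require Import all_boot all_order all_algebra.
From mathcomp Require Import all_classical all_reals all_analysis.
From mathcomp Require Import complex qpoly.
From mathcomp Require Import ring lra.

Set Implicit Arguments.
Unset Strict Implicit.
Unset Printing Implicit Defensive.

Import Order.TTheory GRing.Theory Num.Theory.
Import numFieldNormedType.Exports.
Local Open Scope ring_scope.
Local Open Scope classical_set_scope.
Local Open Scope complex_scope.

(** * One-dimensional integrals *)

Section Integral1.
Context {R : realType}.
Notation mu := (@lebesgue_measure R).
Implicit Types (f g : R -> R) (M : R).

(** Ellipticity is given only as hypoellipticity, a qualitative statement without estimates. Bounds
    on derivatives of solutions are extracted from it by applying uniform boundedness to difference
    quotients: on each single solution they converge, because it is smooth, hence they are bounded
    uniformly over all solutions of norm at most 1. The norm is a polynomially weighted supremum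
    over the whole space, since it has to absorb the growth d(0, z)^eta after every translation and
    dilation. The obstacle in the compactness step is that the seminorm [U] says nothing about the
    coefficients of its polynomials P. But on a coordinate line P has bounded degree and is bounded
    on a unit interval, because V_n is; interpolation turns this into a Lipschitz bound there. The
    blow-up loses nothing because the germ norm, [U] and [L U] all carry the same power of lam: the
    factor lam^(-eta) cancels it in each of them. Finiteness of the norm is what allows dividing by
    it. *)

Definition cc1 M g := continuous g /\ forall t, M < `|t| -> g t = 0.

Lemma cc1_restrict M g : cc1 M g -> (g \_ `[- M, M]) = g.
Proof.
move=> [_ g0]; apply/funext => t; rewrite patchE.
case: ifPn => // /negP tM; rewrite g0 // ltNge; apply/negP => le.
by apply: tM; rewrite inE /= in_itv /= -ler_norml.
Qed.

Lemma cc1_integrable_itv M g (a b : R) : cc1 M g ->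
  mu.-integrable `[a, b] (EFin \o g).
Proof.
move=> [gc _]; apply: continuous_compact_integrable; first exact: segment_compact.
exact/continuous_subspaceT.
Qed.

Lemma cc1_integrable M g : cc1 M g -> mu.-integrable setT (EFin \o g).
Proof.
move=> gc; rewrite -(cc1_restrict gc) -restrict_EFin.
have H := @integrable_mkcond _ _ R mu `[- M, M]%classic (EFin \o g) (measurable_itv _).
by apply H; exact: cc1_integrable_itv gc.
Qed.

Lemma cc1_int_itv M g : cc1 M g ->
  Rintegral mu setT g = Rintegral mu `[- M, M] g.
Proof. by move=> gc; rewrite [RHS]Rintegral_mkcond cc1_restrict. Qed.

Lemma int1_lin M f g c : cc1 M f -> cc1 M g ->
  Rintegral mu setT (fun t => c * f t + g t)
  = c * Rintegral mu setT f + Rintegral mu setT g.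
Proof.
move=> fc gc; rewrite RintegralD //.
- by rewrite RintegralZl //; exact: cc1_integrable fc.
- have := integrableZl measurableT c (cc1_integrable fc).
  by apply: eq_integrable => // x _.
- exact: cc1_integrable gc.
Qed.

Lemma int_cst_itv (a b c : R) : a <= b ->
  Rintegral mu `[a, b] (fun=> c) = c * (b - a).
Proof.
move=> ab; rewrite Rintegral_cst //; congr (_ * _).
have E := @lebesgue_measure_itv R `[a, b]%R; rewrite /= lte_fin in E.
transitivity (fine (if a < b then (b%:E - a%:E)%E else 0%E)); first by rewrite -E.
by case: ltP => // ba /=; apply/esym/eqP; rewrite subr_eq0 eq_le ab ba.
Qed.

Lemma int1_bound M g (B : R) : 0 <= M -> cc1 M g -> (forall t, `|g t| <= B) ->
  `|Rintegral mu setT g| <= 2 * M * B.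
Proof.
move=> M0 gc gB; rewrite (cc1_int_itv gc).
have I1 := @cc1_integrable_itv M g (- M) M gc.
apply: (le_trans (le_normr_Rintegral _ I1)) => //.
have -> : 2 * M * B = Rintegral mu `[- M, M] (fun=> B).
  by rewrite int_cst_itv; [ring|lra].
apply: le_Rintegral => //.
- by apply/integrable_norm; exact: cc1_integrable_itv gc.
- have cB : continuous (fun _ : R => B) by move=> x; exact: cst_continuous.
  apply: continuous_compact_integrable; first exact: segment_compact.
  exact/continuous_subspaceT.
Qed.

Lemma int1_gt0 M g (t0 : R) : cc1 M g -> (forall t, 0 <= g t) -> 0 < g t0 ->
  0 < Rintegral mu setT g.
Proof.
move=> gc g0 gt0.
have [e e0 he] : exists2 e : R, 0 < e & forall t, `|t0 - t| < e -> g t0 / 2 <= g t.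
  have /cvgrPdist_lt/(_ (g t0 / 2)) := gc.1 t0.
  rewrite divr_gt0 // => /(_ isT)/nbhs_ballP[e /= e0 he]; exists e => // t lt.
  by have := he t lt; rewrite ltr_norml; lra.
set I : set R := `[t0 - e / 2, t0 + e / 2]%classic.
have Iint : mu.-integrable I (EFin \o g) by exact: cc1_integrable_itv gc.
have le1 : Rintegral mu I g <= Rintegral mu setT g.
  rewrite (Rintegral_mkcond mu I); apply: le_Rintegral => //.
  - have H := @integrable_mkcond _ _ R mu I (EFin \o g) (measurable_itv _).
    by rewrite -restrict_EFin; apply H.
  - exact: cc1_integrable gc.
  - by move=> x _; rewrite patchE; case: ifP.
apply: lt_le_trans le1.
have : Rintegral mu I (fun=> g t0 / 2) <= Rintegral mu I g.
  apply: le_Rintegral => //.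
      exact: measurable_itv.
    have cB : continuous (fun _ : R => g t0 / 2) by move=> x; exact: cst_continuous.
    apply: continuous_compact_integrable; first exact: segment_compact.
    exact/continuous_subspaceT.
  move=> t; rewrite /I /= in_itv /= => /andP[h1 h2]; apply: he.
  by rewrite ltr_norml; lra.
apply: lt_le_trans.
by rewrite int_cst_itv; [rewrite mulr_gt0 //; lra|lra].
Qed.

Lemma affine_continuous (a b : R) : continuous (fun t : R => b + a * t).
Proof.
move=> t; apply: cvgD; first exact: cvg_cst.
by apply: cvgM; [exact: cvg_cst|exact: cvg_id].
Qed.

Lemma cc1_affine M g (a b : R) : 0 < a -> cc1 M g ->
  cc1 (a^-1 * (`|M| + `|b|)) (fun t => g (b + a * t)).
Proof.
move=> a0 gc; split.
  by move=> t; apply: continuous_comp; [exact: affine_continuous|exact: gc.1].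
  move=> t; rewrite ltr_pdivrMl // => lt; apply: gc.2.
  have : `|a * t| <= `|b + a * t| + `|b|.
    by have := ler_normB (b + a * t) b; rewrite addrC addKr.
  rewrite normrM (gtr0_norm a0); have := ler_norm M; lra.
Qed.

Lemma cc1_0 M : cc1 M (fun=> 0).
Proof. by split => // t; exact: cst_continuous. Qed.

Lemma int1_0 : Rintegral mu setT (fun=> 0) = 0.
Proof. by rewrite /Rintegral integral0. Qed.

Lemma int1_affine M g (a b : R) : 0 < a -> cc1 M g ->
  Rintegral mu setT (fun t => g (b + a * t)) = a^-1 * Rintegral mu setT g.
Proof.
move=> a0 gc.
have cF := @affine_continuous a b.
have hc := cc1_affine b a0 gc.
(* The map t -> b + a t sends [-N, N] onto an interval that contains [-M, M], so both integrals over
   the line become integrals over compact intervals. *)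
set N := a^-1 * (`|M| + `|b|) in hc.
have N0 : 0 <= N by rewrite mulr_ge0 // ?addr_ge0 // invr_ge0 ltW.
have dF : forall t, (fun t : R => b + a * t)^`() t = a.
  move=> t; rewrite derive1E.
  have : is_derive t (1 : R) (fun t : R => b + a * t) (0 + a *: 1).
    by apply: is_deriveD.
  by move/(@derive_val _ _ _ _ _ _ _) => ->; rewrite add0r scaler1.
have sub := @integration_by_substitution_increasing R (fun t => b + a * t) g (- N) N.
have {sub} : (\int[mu]_(x in `[(b + a * - N)%R, (b + a * N)%R]) (g x)%:E =
   \int[mu]_(x in `[(- N)%R, N]) ((g (b + a * x) * a)%R%:E))%E.
  rewrite sub.
  - by apply: eq_integral => x _; congr (_%:E); congr (_ * _); rewrite dF.
  - lra.
  - by move=> x y _ _ xy; rewrite ltrD2l ltr_pM2l.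
  - by move=> x _; rewrite (_ : _^`() = fun=> a); [exact: cst_continuous|exact/funext].
  - by rewrite (_ : _^`() = fun=> a); [exact: is_cvg_cst|exact/funext].
  - by rewrite (_ : _^`() = fun=> a); [exact: is_cvg_cst|exact/funext].
  - split.
    + by move=> x _; apply: derivableD => //; apply: derivableM.
    + by apply: cvg_at_right_filter; exact: cF.
    + by apply: cvg_at_left_filter; exact: cF.
  - by apply: continuous_subspaceT; exact: gc.1.
move=> /(congr1 fine); rewrite -!/(Rintegral _ _ _) => E.
have E2 : Rintegral mu `[- N, N] (fun x => g (b + a * x) * a) =
    Rintegral mu setT (fun t => g (b + a * t)) * a.
  by rewrite RintegralZr //; [rewrite -(cc1_int_itv hc)|exact: cc1_integrable_itv hc].
have E1 : Rintegral mu `[b + a * - N, b + a * N] g = Rintegral mu setT g.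
  rewrite Rintegral_mkcond; congr Rintegral; apply/funext => t; rewrite patchE.
  case: ifPn => // /negP tN; apply/esym/gc.2; rewrite ltNge; apply/negP => le.
  apply: tN; rewrite inE /= in_itv /=.
  have -> : a * - N = - (`|M| + `|b|) by rewrite /N; field; rewrite gt_eqF.
  have -> : a * N = `|M| + `|b| by rewrite /N; field; rewrite gt_eqF.
  have := ler_norm M; have := ler_norm b; have := ler_norm (- b); rewrite normrN.
  move: le; rewrite ler_norml; lra.
have -> : Rintegral mu setT g = Rintegral mu setT (fun t => g (b + a * t)) * a.
  by rewrite -E1 -E2; exact: E.
by field; rewrite gt_eqF.
Qed.

End Integral1.

(** * Iterated integrals *)

Section IntegralN.
Context {R : realType} {d : nat}.
Notation mu := (@lebesgue_measure R).
Notation pt := 'rV[R]_d.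
Implicit Types (f g : pt -> R) (M : R) (x y : pt).

(** The invariant of iterated integration: it is what remains true once the coordinates below [n]
    are integrated out. The continuity is uniform because integrating over [-M, M] multiplies a
    uniform modulus by 2M, whereas pointwise continuity would not pass through the integral so
    directly. *)
Definition iinv n M f :=
  (forall e : R, 0 < e -> exists2 r : R, 0 < r &
     forall x y, `|x - y| < r -> `|f x - f y| <= e)
  /\ (forall x (i : 'I_d), (n <= i)%N -> M < `|x 0 i| -> f x = 0).

Lemma normrV_le (x : pt) (r : R) : 0 <= r ->
  (forall i, `|x 0 i| <= r) -> `|x| <= r.
Proof.
move=> r0 h; rewrite [`|x|]/Num.norm /= mx_normrE; apply: bigmax_le => // -[i j] _ /=.
by rewrite (ord1 i).
Qed.

Lemma normrV_ge (x : pt) i : `|x 0 i| <= `|x|.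
Proof.
rewrite [`|x|]/Num.norm /= mx_normrE; apply/bigmax_geP; right => /=.
by exists (0, i).
Qed.

Lemma setc_eq (j : 'I_d) x t : setc j x t 0 j = t.
Proof. by rewrite mxE eqxx. Qed.

Lemma setc_neq (j : nat) x t (i : 'I_d) : (i : nat) != j -> setc j x t 0 i = x 0 i.
Proof. by rewrite mxE => /negbTE ->. Qed.

Lemma setc_id (j : 'I_d) x : setc j x (x 0 j) = x.
Proof. by apply/rowP => i; rewrite mxE; case: eqP => // /val_inj ->. Qed.

Lemma setc_dist j x y t : `|setc j x t - setc j y t| <= `|x - y|.
Proof.
apply: normrV_le => // i; rewrite !mxE; case: eqP => _; first by rewrite subrr normr0.
by have := normrV_ge (x - y) i; rewrite !mxE.
Qed.

Lemma setc_dist2 j x t u : `|setc j x t - setc j x u| <= `|t - u|.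
Proof. by apply: normrV_le => // i; rewrite !mxE; case: eqP => _ //; rewrite subrr normr0. Qed.

Lemma iinv_cc1 n M f x (j : 'I_d) : (n <= j)%N -> iinv n M f ->
  cc1 M (fun t => f (setc j x t)).
Proof.
move=> nj [fu f0]; split; last by move=> t lt; apply: (f0 _ j) => //; rewrite setc_eq.
move=> t; apply/cvgrPdist_le => e e0; have [r r0 h] := fu e e0.
near=> u; apply: h; apply: le_lt_trans (setc_dist2 _ _ _ _) _.
by near: u; apply: cvgr_dist_lt.
Unshelve. all: by end_near. Qed.

Lemma iinv_aux M f n : 0 <= M -> (n <= d)%N -> iinv 0 M f -> iinv n M (iint_aux n f).
Proof.
move=> M0; elim: n => [//|n IH] nd fi; have Gi := IH (ltnW nd) fi.
pose j := Ordinal nd; split; last first.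
  move=> x i ni lt /=; rewrite (_ : (fun t => _) = fun=> 0); first by rewrite /Rintegral integral0.
  apply/funext => t; apply: (Gi.2 _ i); first exact: ltnW.
  by rewrite setc_neq // gtn_eqF.
(* Integration costs a factor 2M; the 1 keeps the denominator positive when [M] is 0. *)
move=> e e0; have e0' : 0 < e / (2 * M + 1) by rewrite divr_gt0 //; lra.
have [r r0 h] := Gi.1 _ e0'; exists r => // x y xy /=.
have cx := iinv_cc1 x (leqnn n : (n <= j)%N) Gi.
have cy := iinv_cc1 y (leqnn n : (n <= j)%N) Gi.
have := int1_lin (-1) cy cx.
rewrite mulN1r addrC => <-.
have cxy : cc1 M (fun t => -1 * iint_aux n f (setc j y t) + iint_aux n f (setc j x t)).
  split; last by move=> t lt; rewrite cx.2 // cy.2 // mulr0 addr0.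
  move=> t; apply: cvgD; last exact: cx.1.
  by apply: cvgM; [exact: cvg_cst|exact: cy.1].
apply: le_trans (int1_bound M0 cxy (B := e / (2 * M + 1)) _) _.
  move=> t; rewrite mulN1r addrC; apply: h.
  exact: le_lt_trans (setc_dist _ _ _ _) xy.
by rewrite mulrA ler_pdivrMr; nra.
Qed.

Lemma iint_lin M f g c n x : 0 <= M -> (n <= d)%N -> iinv 0 M f -> iinv 0 M g ->
  iint_aux n (fun y => c * f y + g y) x = c * iint_aux n f x + iint_aux n g x.
Proof.
move=> M0 nd fi gi; elim: n nd x => [//|n IH] nd x /=.
pose j := Ordinal nd.
have cf := iinv_cc1 x (leqnn n : (n <= j)%N) (iinv_aux M0 (ltnW nd) fi).
have cg := iinv_cc1 x (leqnn n : (n <= j)%N) (iinv_aux M0 (ltnW nd) gi).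
rewrite -(int1_lin c cf cg); congr Rintegral; apply/funext => t.
exact/IH/ltnW.
Qed.

Lemma iint_bound M f B n x : 0 <= M -> (n <= d)%N -> iinv 0 M f ->
  (forall y, `|f y| <= B) -> `|iint_aux n f x| <= (2 * M) ^+ n * B.
Proof.
move=> M0 nd fi fB; elim: n nd x => [|n IH] nd x; first by rewrite mul1r; exact: fB.
pose j := Ordinal nd.
have cf := iinv_cc1 x (leqnn n : (n <= j)%N) (iinv_aux M0 (ltnW nd) fi).
rewrite exprS -mulrA; apply: int1_bound M0 cf _ => t; exact/IH/ltnW.
Qed.

Lemma iint_ge0 f n x : (forall y, 0 <= f y) -> 0 <= iint_aux n f x.
Proof.
move=> f0; elim: n x => [|n IH] x /=; first exact: f0.
by apply: Rintegral_ge0 => t _; exact: IH.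
Qed.

(** The base point is the very point where [f] is positive, so each section is again positive at its
    own coordinate. [iint_dep] later moves the base point of [integral] from 0 to [x]. *)
Lemma iint_gt0 M f n x : 0 <= M -> (n <= d)%N -> iinv 0 M f ->
  (forall y, 0 <= f y) -> 0 < f x -> 0 < iint_aux n f x.
Proof.
move=> M0 nd fi f0 fx; elim: n nd => [//|n IH] nd /=.
pose j := Ordinal nd.
have cf := iinv_cc1 x (leqnn n : (n <= j)%N) (iinv_aux M0 (ltnW nd) fi).
apply: (int1_gt0 (t0 := x 0 j) cf).
  by move=> t; exact: iint_ge0.
by rewrite (_ : setc j x _ = x) ?setc_id //; exact/IH/ltnW.
Qed.

Lemma iint_dep f n x y : (forall i : 'I_d, (n <= i)%N -> x 0 i = y 0 i) ->
  iint_aux n f x = iint_aux n f y.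
Proof.
elim: n x y => [|n IH] x y xy /=; first by congr f; apply/rowP => i; exact: xy.
congr Rintegral; apply/funext => t; apply: IH => i ni; rewrite !mxE.
by case: eqP => // /eqP ne; apply: xy; rewrite ltn_neqAle eq_sym ne.
Qed.

Definition affm (p : pt) (r : 'I_d -> R) (y : pt) : pt := \row_i (p 0 i + r i * y 0 i).

Lemma iint_affm M f n p r y : 0 <= M -> (n <= d)%N -> (forall i, 0 < r i) -> iinv 0 M f ->
  iint_aux n (fun y => f (affm p r y)) y =
  (\prod_(i < d | (i < n)%N) (r i)^-1) * iint_aux n f (affm p r y).
Proof.
move=> M0 nd r0 fi; elim: n nd y => [|n IH] nd y.
  by rewrite big_pred0 ?mul1r // => i.
pose j := Ordinal nd.
have cf := iinv_cc1 (affm p r y) (leqnn n : (n <= j)%N) (iinv_aux M0 (ltnW nd) fi).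
rewrite (bigD1 j) //= (eq_bigl (fun i : 'I_d => (i < n)%N)); last first.
  move=> i; rewrite ltnS leq_eqVlt -val_eqE /=.
  by case: eqP => /= [->|]; rewrite ?ltnn ?andbT.
rewrite mulrAC -(int1_affine (p 0 j) (r0 j) cf).
have cf2 : cc1 ((r j)^-1 * (`|M| + `|p 0 j|)) (fun t => iint_aux n f (setc n (affm p r y) (p 0 j + r j * t))).
  exact: (cc1_affine (p 0 j) (r0 j) cf).
have := int1_lin (\prod_(i < d | (i < n)%N) (r i)^-1) cf2 (cc1_0 _).
rewrite int1_0 addr0 mulrC => <-.
congr Rintegral; apply/funext => t; rewrite addr0 IH; last exact: ltnW.
congr (_ * iint_aux _ _ _); apply/rowP => i; rewrite !mxE.
by case: eqP => // E; rewrite (_ : i = j) //; apply/val_inj.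
Qed.

(** * Compactly supported continuous functions and their integrals *)

Lemma compact_closed_ball (r : R) : compact [set x : pt | `|x| <= r].
Proof.
apply: bounded_closed_compact.
  by exists r; split; [exact: num_real|move=> z lt x /= /le_trans; apply; exact: ltW].
apply: closed_comp (@closed_le R r) => x _; exact: norm_continuous.
Qed.

Lemma cont_cst (c : R) : continuous (fun _ : pt => c).
Proof. by move=> x; exact: cst_continuous. Qed.

Lemma contD f g : continuous f -> continuous g -> continuous (fun x => f x + g x).
Proof. by move=> fc gc x; exact: (cvgD (fc x) (gc x)). Qed.

Lemma contM f g : continuous f -> continuous g -> continuous (fun x => f x * g x).
Proof. by move=> fc gc x; exact: (cvgM (fc x) (gc x)). Qed.

Lemma affm_cont p r : continuous (affm p r).
Proof.
move=> x; suff H : forall e : R, 0 < e -> \forall y \near (x : pt), `|affm p r x - affm p r y| <= e.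
  by move/cvgrPdist_le : H; exact.
move=> e e0; near=> y.
apply: normrV_le; first exact: ltW.
move=> i; rewrite !mxE (_ : _ - _ = r i * (x 0 i - y 0 i)); last by ring.
rewrite normrM; apply: (@le_trans _ _ ((`|r i| + 1) * `|x - y|)).
  have := normrV_ge (x - y) i; rewrite !mxE => h.
  by apply: ler_pM => //; rewrite lerDl.
apply: (@le_trans _ _ ((\sum_j `|r j| + 1) * `|x - y|)).
  apply: ler_wpM2r => //; rewrite lerD2r (bigD1 i) //= lerDl; exact: sumr_ge0.
rewrite mulrC -ler_pdivlMr; last by apply: ltr_wpDl => //; exact: sumr_ge0.
near: y; apply: cvgr_dist_le; first exact: cvg_id.
by rewrite divr_gt0 //; apply: ltr_wpDl => //; exact: sumr_ge0.
Unshelve. all: by end_near. Qed.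

Definition Cc f := continuous f /\ exists M, forall x, M < `|x| -> f x = 0.

Lemma Cc_inv f : Cc f -> exists2 M, 0 <= M & iinv 0 M f.
Proof.
move=> [fc [M0 f0]]; pose M := `|M0|; exists M; first exact: normr_ge0.
have fM x : M < `|x| -> f x = 0.
  by move=> lt; apply: f0; apply: le_lt_trans lt; exact: ler_norm.
split; last by move=> x i _ lt; apply: fM; apply: lt_le_trans lt _; exact: normrV_ge.
move=> e e0.
have cK := @compact_closed_ball (M + 1).
(* Uniform continuity in the form: for increments h near 0, |f(x + h) - f(x)| is small for all x of
   the ball at once. *)
have /compact_near_coveringP/(_ _ (nbhs (0 : pt)) (fun h x => `|f (x + h) - f x| <= e)) := cK.
have cov : forall x, [set x : pt | `|x| <= M + 1] x ->
    \forall x' \near x & i \near (0 : pt), `|f (x' + i) - f x'| <= e.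
  move=> x _.
  have c1 : (fun z : pt * pt => f (z.1 + z.2) - f z.1) z @[z --> (x, 0 : pt)] --> f (x + 0) - f x.
    apply: cvgB.
      apply: (@cvg_comp _ _ _ (fun z : pt * pt => z.1 + z.2) f _ (nbhs (x + 0))); last exact: fc.
      by apply: cvgD; [exact: cvg_fst|exact: cvg_snd].
    by apply: (@cvg_comp _ _ _ (fun z : pt * pt => z.1) f _ (nbhs x)); [exact: cvg_fst|exact: fc].
  rewrite addr0 subrr in c1; have /cvgr0Pnorm_le/(_ e e0) := c1; exact.
move=> /(_ _ cov)/nbhs_ballP[r /= r0 h].
(* The bound 1 matches the radius M + 1: if [y] lies outside the larger ball, then [x] is still
   outside the support and both values vanish. *)
exists (Num.min r 1); first by rewrite lt_min r0 ltr01.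
move=> x y; rewrite lt_min => /andP[xr x1].
have [yM|yM] := leP `|y| (M + 1).
  have := h (x - y) _ y yM; rewrite (addrC y) subrK; apply.
  by rewrite -ball_normE /= sub0r normrN.
have xM : M < `|x|.
  have := ler_distD x y 0; rewrite !subr0 distrC; lra.
by rewrite !fM ?subrr ?normr0 ?(ltW e0) //; lra.
Qed.

Lemma iinvW n M M' f : M <= M' -> iinv n M f -> iinv n M' f.
Proof. by move=> le [h1 h2]; split => // x i ni lt; apply: (h2 x i ni); exact: le_lt_trans lt. Qed.

Lemma Cc_inv2 f g : Cc f -> Cc g -> exists2 M, 0 <= M & iinv 0 M f /\ iinv 0 M g.
Proof.
move=> /Cc_inv[M M0 fi] /Cc_inv[N N0 gi]; exists (M + N); first exact: addr_ge0.
by split; [apply: iinvW fi|apply: iinvW gi]; rewrite ?lerDl ?lerDr.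
Qed.

Lemma integral_lin f g c : Cc f -> Cc g ->
  Defs.integral (fun y => c * f y + g y) = c * Defs.integral f + Defs.integral g.
Proof. by move=> fc gc; have [M M0 [fi gi]] := Cc_inv2 fc gc; exact: iint_lin M0 _ fi gi. Qed.

Lemma integral_bound M f B : 0 <= M -> continuous f -> (forall x, M < `|x| -> f x = 0) ->
  (forall y, `|f y| <= B) -> `|Defs.integral f| <= (2 * M) ^+ d * B.
Proof.
move=> M0 fc f0 fB; have [N N0 [fu _]] : exists2 M, 0 <= M & iinv 0 M f.
  by apply: Cc_inv; split => //; exists M.
apply: iint_bound => //; split => // x i _ lt; apply: f0; apply: lt_le_trans lt _; exact: normrV_ge.
Qed.

Lemma integral_gt0 f x : Cc f -> (forall y, 0 <= f y) -> 0 < f x -> 0 < Defs.integral f.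
Proof.
move=> /Cc_inv[M M0 fi] f0 fx; rewrite /Defs.integral (iint_dep _ (y := x)); first exact: iint_gt0 fi f0 fx.
by move=> i; rewrite leqNgt ltn_ord.
Qed.

Lemma integral_affm f p r : (forall i, 0 < r i) -> Cc f ->
  Defs.integral (fun y => f (affm p r y)) = (\prod_i (r i)^-1) * Defs.integral f.
Proof.
move=> r0 /Cc_inv[M M0 fi]; rewrite /Defs.integral (iint_affm p _ M0 (leqnn d) r0 fi); congr (_ * _).
  by apply: eq_bigl => i; rewrite ltn_ord.
by apply: iint_dep => i; rewrite leqNgt ltn_ord.
Qed.

End IntegralN.

(** * Smooth functions and bumps *)

Section Smooth.
Context {R : realType} {d : nat}.
Notation pt := 'rV[R]_d.
Implicit Types (f g : pt -> R) (x y p : pt) (i : 'I_d) (l : seq 'I_d).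

Lemma derivable_line f x (v : pt) :
  derivable f x v <-> derivable (fun h : R => f (h *: v + x)) 0 1.
Proof.
rewrite /derivable.
rewrite (_ : (fun h : R => h^-1 *: (f (h *: v + x) - f x)) =
  (fun h : R => h^-1 *: ((fun h : R => f (h *: v + x)) (h *: 1 + 0) - (fun h : R => f (h *: v + x)) 0))) //.
by apply/funext => h /=; rewrite scale0r add0r addr0 [h *: 1]mulr1.
Qed.

Lemma derive_line f x (v : pt) : 'D_v f x = 'D_1 (fun h : R => f (h *: v + x)) 0.
Proof.
rewrite /derive.
suff -> : (fun h : R => h^-1 *: ((f \o shift x) (h *: v) - f x)) =
  (fun h : R => h^-1 *: (((fun h : R => f (h *: v + x)) \o shift 0) (h *: 1) - f (0 *: v + x))) by [].
by apply/funext => h /=; rewrite scale0r add0r addr0 [h *: 1]mulr1.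
Qed.

Lemma is_derive_line f x (v : pt) D :
  is_derive (0 : R) (1 : R) (fun h : R => f (h *: v + x)) D -> is_derive x v f D.
Proof.
move=> H; apply: DeriveDef; first by apply/derivable_line; exact: ex_derive.
by rewrite derive_line derive_val.
Qed.

Lemma pd_affm f c p (r : 'I_d -> R) i x : derivable f (affm p r x) (evec R i) ->
  is_derive x (evec R i) (fun y => c * f (affm p r y)) (c * r i * pd i f (affm p r x)).
Proof.
move=> /derivable_line df; apply: is_derive_line.
have E : (fun h : R => c * f (affm p r (h *: evec R i + x))) =
  (fun h : R => c * (fun u : R => f (u *: evec R i + affm p r x)) (r i * h)).
  apply/funext => h; congr (c * f _); apply/rowP => j; rewrite !mxE.
  by case: (i =P j) => [->|_] /=; ring.
rewrite E {E}; pose F u := f (u *: evec R i + affm p r x); rewrite -/F.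
have dF : is_derive (r i * 0 : R) (1 : R) F (pd i f (affm p r x)).
  by rewrite mulr0 /pd derive_line; exact/derivableP.
have dl : is_derive (0 : R) (1 : R) (fun h : R => r i * h) (r i).
  have := @is_deriveZ R R R id (r i) 0 1 1 (is_derive_id _ _).
  by rewrite [_ *: 1]mulr1.
have := @is_deriveZ _ _ _ _ c _ _ _ (is_derive1_comp dF dl).
by rewrite [_ *: (_ * _)]mulrA mulrAC.
Qed.

(** Smoothness quantifies over all iterated derivatives; a class stable under each [pd i] contains
    them all, so no higher derivative has to be computed. *)
Lemma smoothR_coind (S : (pt -> R) -> Prop) :
  (forall f, S f -> continuous f) ->
  (forall f i x, S f -> derivable f x (evec R i)) ->
  (forall f i, S f -> S (pd i f)) ->
  forall f, S f -> smoothR setT f.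
Proof.
move=> Sc Sd Sp f Sf l.
have : S (pdl l f) by elim: l => [//|i l IH] /=; exact: Sp.
by move=> Sl; split => [x _|i x _]; [exact: Sc|exact: Sd].
Qed.

Lemma smoothR_cont f : smoothR setT f -> continuous f.
Proof. by move=> fs x; have [+ _] := fs [::]; exact. Qed.

Lemma smoothR_derivable f i x : smoothR setT f -> derivable f x (evec R i).
Proof. by move=> fs; have [_] := fs [::]; exact. Qed.

Lemma smoothR_pdl f l : smoothR setT f -> smoothR setT (pdl l f).
Proof. by move=> fs l'; have := fs (l' ++ l); rewrite /pdl foldr_cat. Qed.

Lemma pdl_affm f c p (r : 'I_d -> R) l : smoothR setT f ->
  pdl l (fun y => c * f (affm p r y)) =
  (fun y => (c * \prod_(i <- l) r i) * pdl l f (affm p r y)).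
Proof.
move=> fs; elim: l => [|i l IH]; first by apply/funext => y; rewrite big_nil mulr1.
apply/funext => y /=; rewrite IH {1}/pd.
have /(pd_affm (c * \prod_(j <- l) r j)) D := smoothR_derivable (i := i) (x := affm p r y) (smoothR_pdl l fs).
by rewrite derive_val big_cons; congr (_ * _); ring.
Qed.

Lemma smoothR_affm f c p (r : 'I_d -> R) : smoothR setT f ->
  smoothR setT (fun y => c * f (affm p r y)).
Proof.
move=> fs; pose S g := exists c f, smoothR setT f /\ g = fun y => c * f (affm p r y).
apply: (@smoothR_coind S); last by exists c, f.
- move=> _ [{}c [{}f [{}fs ->]]]; apply: contM; first exact: cont_cst.
  by move=> x; apply: continuous_comp; [exact: affm_cont|exact: smoothR_cont].
- move=> _ i x [{}c [{}f [{}fs ->]]].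
  by have /(pd_affm c)/@ex_derive := smoothR_derivable (i := i) (x := affm p r x) fs.
- move=> _ i [{}c [{}f [{}fs ->]]]; exists (c * r i), (pd i f).
  split; first exact: (smoothR_pdl [:: i] fs).
  by have := pdl_affm c p r [:: i] fs; rewrite /= big_seq1.
Qed.

Lemma pd_lin f g c i x : derivable f x (evec R i) -> derivable g x (evec R i) ->
  is_derive x (evec R i) (fun y => c * f y + g y) (c * pd i f x + pd i g x).
Proof.
by move=> df dg; exact: (is_deriveD (is_deriveZ c (derivableP df)) (derivableP dg)).
Qed.

Lemma pdl_lin f g c l : smoothR setT f -> smoothR setT g ->
  pdl l (fun y => c * f y + g y) = (fun y => c * pdl l f y + pdl l g y).
Proof.
move=> fs gs; elim: l => [//|i l IH]; apply/funext => y /=; rewrite IH {1}/pd.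
have D := pd_lin c (smoothR_derivable (i := i) (x := y) (smoothR_pdl l fs)) (smoothR_derivable (i := i) (x := y) (smoothR_pdl l gs)).
by rewrite derive_val.
Qed.

Lemma pdl_support f (M : R) l : (forall x, M < `|x| -> f x = 0) ->
  forall x, M < `|x| -> pdl l f x = 0.
Proof.
move=> f0; elim: l => [//|i l IH] x Mx /=; rewrite /pd.
have : \near x, pdl l f x = 0.
  have : \forall y \near x, M < `|y|.
    have := @norm_continuous R pt x; move/(cvgr_gt `|x|)/(_ M Mx); exact.
  by apply: filterS => y; exact: IH.
move=> N; rewrite -(@derive_cst R pt R 0 x (evec R i)).
by apply: near_eq_derive.
Qed.

End Smooth.

(** * Flat exponentials and bump functions *)

Section Bump.
Context {R : realType} {d : nat}.
Notation pt := 'rV[R]_d.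
Implicit Types (p q : {poly R}) (t : R).

(** The flat function exp(-1/t) is carried together with a polynomial in 1/t so that the family is
    closed under differentiation. *)
Definition fexp p t : R := if 0 < t then p.[t^-1] * expR (- t^-1) else 0.

Lemma poly_exp_bounded p : exists C : R, forall u, 0 < u -> `|p.[u] * expR (- u)| <= C.
Proof.
elim/poly_ind: p => [|p c _]; first by exists 0 => u _; rewrite horner0 mul0r normr0.
suff mono n : exists C : R, forall u : R, 0 < u -> `|u ^+ n * expR (- u)| <= C.
  move: (p * 'X + c%:P) => q.
  have [C hC] := choice mono.
  exists (\sum_(i < size q) `|q`_i| * C i) => u u0.
  rewrite horner_coef mulr_suml; apply: le_trans (ler_norm_sum _ _ _) _.
  apply: ler_sum => i _; rewrite -mulrA normrM ler_wpM2l //.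
  exact: hC.
(* From exp(u/n) >= 1 + u/n >= u/n, raised to the power n. *)
exists (n%:R ^+ n) => u u0; rewrite ger0_norm; last by rewrite mulr_ge0 ?expR_ge0 ?exprn_ge0 // ltW.
case: n => [|n]; first by rewrite !expr0 mul1r -expR0 ler_expR oppr_le0 ltW.
rewrite expRN ler_pdivrMr ?expR_gt0 //.
have -> : expR u = expR (u / n.+1%:R) ^+ n.+1 by rewrite -expRM_natl -mulr_natl mulrCA divff ?mulr1.
rewrite -exprMn ler_pXn2r ?nnegrE ?mulr_ge0 ?expR_ge0 ?(ltW u0) //.
rewrite -ler_pdivrMl // mulrC; apply: le_trans (expR_ge1Dx _).
by rewrite lerDr.
Qed.

(** Quadratic decay at 0 makes the difference quotient there tend to 0, which settles the one point
    where the two branches of [fexp] meet. It is the boundedness of u^2 p(u) exp(-u) at u = 1/t. *)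
Lemma fexp_quad p : exists C : R, forall t, `|fexp p t| <= C * t ^+ 2.
Proof.
have [C hC] := poly_exp_bounded (p * 'X ^+ 2).
have C0 : 0 <= C by apply: le_trans (hC 1 ltr01).
exists C => t; rewrite /fexp; case: ltP => t0; last by rewrite normr0 mulr_ge0 ?sqr_ge0.
have := hC t^-1; rewrite invr_gt0 => /(_ t0); rewrite hornerM hornerXn.
rewrite mulrAC normrM (ger0_norm (x := t^-1 ^+ 2)) ?sqr_ge0 // exprVn ler_pdivrMr //.
by rewrite exprn_gt0.
Qed.

(** The chain rule with u = 1/t and u' = -u^2 turns p(u) exp(-u) into u^2 (p - p')(u) exp(-u). *)
Definition dfexp p := 'X ^+ 2 * (p - p^`()).

Lemma fexp_derive p t : is_derive t (1 : R) (fexp p) (fexp (dfexp p) t).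
Proof.
have [t0|t0|t0] := ltgtP 0 t.
- pose g u : R := p.[u^-1] * expR (- u^-1).
  have N : \near t, fexp p t = g t.
    near=> u; rewrite /fexp ifT //; near: u; exact: lt_nbhsr.
  have dV : is_derive t (1 : R) (fun u : R => u^-1) (- t^-1 ^+ 2).
    have := @is_deriveV R id t 1 1 (lt0r_neq0 t0) (is_derive_id _ _).
    by rewrite [_ *: 1]mulr1 exprVn.
  have dp : is_derive t (1 : R) (fun u : R => p.[u^-1]) (p^`().[t^-1] * (- t^-1 ^+ 2)).
    by apply: (@is_derive1_comp _ (fun u => p.[u]) (fun u => u^-1)); exact: is_derive_poly.
  have dN : is_derive t (1 : R) (fun u : R => - u^-1) (t^-1 ^+ 2).
    by have := is_deriveN dV; rewrite opprK.
  have de : is_derive t (1 : R) (fun u : R => expR (- u^-1)) (expR (- t^-1) * (t^-1 ^+ 2)).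
    by apply: (@is_derive1_comp _ expR (fun u => - u^-1)); exact: is_derive_expR.
  have dg := is_deriveM dp de.
  have dg' : is_derive t (1 : R) g (fexp (dfexp p) t).
    apply: is_derive_eq dg _; rewrite /fexp t0 /dfexp !hornerE /GRing.scale /=; ring.
  apply: DeriveDef.
    apply: (near_eq_derivable (f := g)); last exact: ex_derive.
    by apply: filterS N => u ->.
  by rewrite (near_eq_derive _ N) derive_val.
- have N : \near t, fexp p t = cst 0 t.
    near=> u; rewrite /fexp ifF //; apply/negbTE; rewrite -leNgt ltW //; near: u; exact: lt_nbhsl.
  rewrite {2}/fexp ltNge (ltW t0) /=; apply: DeriveDef.
    apply: (near_eq_derivable (f := cst 0)); last exact: derivable_cst.
    by apply: filterS N => u ->.
  by rewrite (near_eq_derive _ N) derive_cst.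
- rewrite -{}t0 {2}/fexp ltxx.
  have [C hC] := fexp_quad p.
  have L : (fun h : R => h^-1 *: (fexp p (h *: 1 + 0) - fexp p 0)) @ 0^' --> (0 : R).
    apply/cvgr0Pnorm_le => e e0; near=> h.
    have h0 : h != 0 by near: h; exact: nbhs_dnbhs_neq.
    rewrite [h *: 1]mulr1 addr0 {2}/fexp ltxx subr0 normrM normfV ler_pdivrMl ?normr_gt0 //.
    apply: le_trans (hC h) _; rewrite -real_normK ?num_real // expr2 mulrCA.
    apply: ler_wpM2l => //; apply: (@le_trans _ _ ((`|C| + 1) * `|h|)).
      by apply: ler_wpM2r => //; have := ler_norm C; lra.
    rewrite -ler_pdivlMl; last by rewrite ltr_wpDl.
    by near: h; apply: dnbhs0_le; rewrite mulr_gt0 // invr_gt0 ltr_wpDl.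
  apply: DeriveDef; first by apply/cvg_ex; exists 0.
  exact: (cvg_lim (@norm_hausdorff _ _) L).
Unshelve. all: by end_near. Qed.

Lemma fexp_cont p : continuous (fexp p).
Proof.
move=> t; apply: differentiable_continuous; apply/derivable1_diffP.
by have /@ex_derive := fexp_derive p t.
Qed.

(* Being closed under every [pd i], this class of continuous functions is smooth; it contains products of [fexp 1], hence bumps. *)
Inductive fexp_alg : (pt -> R) -> Prop :=
| fa_cst c : fexp_alg (fun=> c)
| fa_fexp (i : 'I_d) p (a b : R) : fexp_alg (fun x => fexp p (a + b * x 0 i))
| fa_add f g : fexp_alg f -> fexp_alg g -> fexp_alg (fun x => f x + g x)
| fa_mul f g : fexp_alg f -> fexp_alg g -> fexp_alg (fun x => f x * g x).

Lemma fexp_alg_cont f : fexp_alg f -> continuous f.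
Proof.
elim=> [c|i p a b|{}f g _ fc _ gc|{}f g _ fc _ gc].
- exact: cont_cst.
- move=> x; apply: (@continuous_comp _ _ _ (fun x : pt => a + b * x 0 i)); last exact: fexp_cont.
  apply: (@contD _ _ (fun=> a)); first exact: cont_cst.
  apply: (@contM _ _ (fun=> b)); first exact: cont_cst.
  exact: coord_continuous.
- exact: contD.
- exact: contM.
Qed.

Lemma fexp_alg_pd f i : fexp_alg f ->
  exists2 g, fexp_alg g & forall x, is_derive x (evec R i) f (g x).
Proof.
elim=> [c|j p a b|{}f g fa [f' fa' df] ga [g' ga' dg]|{}f g fa [f' fa' df] ga [g' ga' dg]].
- by exists (fun=> 0); [exact: fa_cst|move=> x; exact: is_derive_cst].
- exists (fun x => (b * (i == j)%:R) * fexp (dfexp p) (a + b * x 0 j)).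
    by apply: fa_mul; [exact: fa_cst|exact: fa_fexp].
  move=> x; apply: is_derive_line.
  have dl : is_derive (0 : R) (1 : R) (fun h : R => a + b * (h *: evec R i + x) 0 j) (b * (i == j)%:R).
    have := @is_deriveD R R R (fun h : R => (b * (i == j)%:R) * h) (cst (a + b * x 0 j)) 0 1 _ _
     (@is_deriveZ R R R id (b * (i == j)%:R) 0 1 1 (is_derive_id _ _)) (is_derive_cst _ _ _).
    rewrite [_ *: 1]mulr1 addr0 => H; apply: is_derive_eq (erefl (b * (i == j)%:R)).
    by rewrite (_ : (fun _ => _) = ([eta *%R (b * (i == j)%:R)] + cst (a + b * x 0 j))) //; apply/funext => h /=; rewrite !mxE [RHS]/GRing.add /=; ring.
  have := @is_derive1_comp _ (fexp p) _ _ _ _ (fexp_derive p _) dl.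
  by rewrite scale0r add0r mulrC.
- exists (fun x => f' x + g' x); first exact: fa_add.
  by move=> x; exact: is_deriveD.
- exists (fun x => f x * g' x + g x * f' x); first by apply: fa_add; exact: fa_mul.
  by move=> x; exact: is_deriveM.
Qed.

Lemma fexp_alg_smooth f : fexp_alg f -> smoothR setT f.
Proof.
apply: smoothR_coind => {}f; first exact: fexp_alg_cont.
  move=> i x fa; have [g _ dg] := fexp_alg_pd i fa; exact: ex_derive.
move=> i fa; have [g ga dg] := fexp_alg_pd i fa.
rewrite (_ : pd i f = g) //; apply/funext => x; rewrite /pd; exact: derive_val.
Qed.

Lemma fexp1_ge0 t : 0 <= fexp 1 t.
Proof. by rewrite /fexp; case: ifP => // _; rewrite hornerC mul1r expR_ge0. Qed.

Lemma fexp1_gt0 t : 0 < t -> 0 < fexp 1 t.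
Proof. by rewrite /fexp => ->; rewrite hornerC mul1r expR_gt0. Qed.

Lemma bump_exists (x0 : pt) (r : R) : 0 < r ->
  exists b : pt -> R, [/\ smoothR setT b, (forall x, 0 <= b x), 0 < b x0 &
    forall x, r < `|x - x0| -> b x = 0].
Proof.
(* The two factors are positive exactly when x_i > x0_i - r and x_i < x0_i + r; since the norm is
   the maximum norm, the product over i is supported in the ball. *)
move=> r0; pose F i (x : pt) := fexp 1 ((r - x0 0 i) + 1 * x 0 i) * fexp 1 ((r + x0 0 i) + (-1) * x 0 i).
exists (fun x => \prod_i F i x); split.
- apply: fexp_alg_smooth.
  have : forall s : seq 'I_d, fexp_alg (fun x => \prod_(i <- s) F i x).
    elim=> [|i s IH].
      rewrite (_ : (fun _ => _) = fun=> 1); first exact: fa_cst.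
      by apply/funext => x; rewrite big_nil.
    rewrite (_ : (fun _ => _) = fun x => F i x * \prod_(i <- s) F i x).
      by apply: fa_mul => //; apply: fa_mul; exact: fa_fexp.
    by apply/funext => x; rewrite big_cons.
  exact.
- by move=> x; apply: prodr_ge0 => i _; rewrite mulr_ge0 // fexp1_ge0.
- by apply: prodr_gt0 => i _; rewrite mulr_gt0 // fexp1_gt0 //; lra.
- move=> x lt; have [i hi] : exists i, r < `|(x - x0) 0 i|.
    apply: contrapT => H; move: lt; rewrite ltNge => /negP; apply.
    apply: normrV_le; first exact: ltW.
    by move=> i; rewrite leNgt; apply/negP => h; apply: H; exists i.
  rewrite (bigD1 i) //= {1}/F /fexp; move: hi; rewrite !mxE ltr_normr => hi.
  have [h1|h1] := ltP 0 (r - x0 0 i + 1 * x 0 i); last by rewrite !mul0r.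
  have [h2|h2] := ltP 0 (r + x0 0 i + -1 * x 0 i); last by rewrite mulr0 mul0r.
  by case/orP: hi; lra.
Qed.

End Bump.

(** * Complex test functions *)

Section ComplexAux.
Context {R : realType}.
Implicit Types (z w : R[i]).
Notation Re := complex.Re.
Notation Im := complex.Im.

Lemma ReD z w : Re (z + w) = Re z + Re w. Proof. by case: z w => [a b] [c e]. Qed.
Lemma ImD z w : Im (z + w) = Im z + Im w. Proof. by case: z w => [a b] [c e]. Qed.
Lemma ReM z w : Re (z * w) = Re z * Re w - Im z * Im w.
Proof. by case: z w => [a b] [c e]. Qed.
Lemma ImM z w : Im (z * w) = Re z * Im w + Im z * Re w.
Proof. by case: z w => [a b] [c e]. Qed.
Lemma ReZ (c : R) z : Re (c%:C * z) = c * Re z.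
Proof. by rewrite ReM /= mul0r subr0. Qed.
Lemma ImZ (c : R) z : Im (c%:C * z) = c * Im z.
Proof. by rewrite ImM /= mul0r addr0. Qed.
Lemma complex_ext z w : Re z = Re w -> Im z = Im w -> z = w.
Proof. by case: z w => [a b] [c e] /= -> ->. Qed.

Lemma cabs_Re z : `|Re z| <= cabs z.
Proof.
case: z => [a b]; rewrite /cabs /= -[`|a|]ger0_norm // -sqrtr_sqr ler_wsqrtr //.
by rewrite real_normK ?num_real // lerDl sqr_ge0.
Qed.
Lemma cabs_Im z : `|Im z| <= cabs z.
Proof.
case: z => [a b]; rewrite /cabs /= -[`|b|]ger0_norm // -sqrtr_sqr ler_wsqrtr //.
by rewrite real_normK ?num_real // lerDr sqr_ge0.
Qed.
Lemma cabs_ge0 z : 0 <= cabs z.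
Proof. exact: le_trans (cabs_Re z). Qed.
Lemma cabs_le z : cabs z <= `|Re z| + `|Im z|.
Proof.
case: z => [a b]; rewrite /cabs /= -[leRHS]ger0_norm ?addr_ge0 // -sqrtr_sqr ler_wsqrtr //.
rewrite -(real_normK (num_real a)) -(real_normK (num_real b)).
have := mulr_ge0 (normr_ge0 a) (normr_ge0 b); nra.
Qed.
Lemma cabsM z w : cabs (z * w) = cabs z * cabs w.
Proof. exact: Normc.normcM. Qed.
Lemma cabsD z w : cabs (z + w) <= cabs z + cabs w.
Proof. exact: le_normcD. Qed.
Lemma cabsN z : cabs (- z) = cabs z.
Proof. exact: normcN. Qed.
Lemma cabs0 : cabs (0 : R[i]) = 0.
Proof. exact: Normc.normc0. Qed.
Lemma cabsR (c : R) : cabs c%:C = `|c|.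
Proof. by rewrite /cabs /= expr0n addr0 sqrtr_sqr. Qed.
Lemma cabs_eq0 z : cabs z <= 0 -> z = 0.
Proof. by move=> h; apply: Normc.eq0_normc; apply/eqP; rewrite eq_le h cabs_ge0. Qed.
Lemma cabs_sum (I : Type) (r : seq I) (F : I -> R[i]) (G : I -> R) :
  (forall i, cabs (F i) <= G i) -> cabs (\sum_(i <- r) F i) <= \sum_(i <- r) G i.
Proof.
move=> FG; elim: r => [|i r IH]; first by rewrite !big_nil cabs0.
by rewrite !big_cons; apply: le_trans (cabsD _ _) _; apply: lerD.
Qed.
End ComplexAux.

(** * Complex integrals and test functions *)

Section TestFun.
Context {R : realType} {d : nat}.
Notation pt := 'rV[R]_d.
Notation C := R[i].
Notation Re := complex.Re.
Notation Im := complex.Im.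
Implicit Types (V W phi psi : pt -> C) (f g : pt -> R) (p : pt) (r : 'I_d -> R).

Definition contC V := continuous (fun x => Re (V x)) /\ continuous (fun x => Im (V x)).
Definition CcC V := Cc (fun x => Re (V x)) /\ Cc (fun x => Im (V x)).

Lemma Cc_lin f g c : Cc f -> Cc g -> Cc (fun x => c * f x + g x).
Proof.
move=> [fc [M f0]] [gc [N g0]]; split.
  by apply: contD => //; apply: contM => //; exact: cont_cst.
by exists (Num.max M N) => x; rewrite gt_max => /andP[h1 h2]; rewrite f0 // g0 // mulr0 addr0.
Qed.

Lemma Cc_mul f g : continuous f -> Cc g -> Cc (fun x => f x * g x).
Proof.
move=> fc [gc [N g0]]; split; first exact: contM.
by exists N => x h; rewrite g0 // mulr0.
Qed.

Lemma Cc0 : Cc (fun _ : pt => 0 : R).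
Proof. by split; [exact: cont_cst|exists 0]. Qed.

Lemma CcC_lin c V W : CcC V -> CcC W -> CcC (fun x => c * V x + W x).
Proof.
move=> [V1 V2] [W1 W2]; split.
  rewrite (_ : (fun _ => _) = fun x => Re c * Re (V x) + ((- Im c) * Im (V x) + Re (W x))).
    by do 2 apply: Cc_lin => //.
  by apply/funext => x; rewrite ReD ReM; ring.
rewrite (_ : (fun _ => _) = fun x => Re c * Im (V x) + (Im c * Re (V x) + Im (W x))).
  by do 2 apply: Cc_lin => //.
by apply/funext => x; rewrite ImD ImM; ring.
Qed.

Lemma CcC0 : CcC (fun=> 0).
Proof. by split; exact: Cc0. Qed.

Lemma CcC_mul V W : contC V -> CcC W -> CcC (fun x => V x * W x).
Proof.
move=> [V1 V2] [W1 W2]; split.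
  rewrite (_ : (fun _ => _) = fun x => (-1) * (Im (V x) * Im (W x)) + Re (V x) * Re (W x)).
    by apply: Cc_lin; exact: Cc_mul.
  by apply/funext => x; rewrite ReM; ring.
rewrite (_ : (fun _ => _) = fun x => 1 * (Re (V x) * Im (W x)) + Im (V x) * Re (W x)).
  by apply: Cc_lin; exact: Cc_mul.
by apply/funext => x; rewrite ImM; ring.
Qed.

Lemma CcC_cont V : CcC V -> contC V.
Proof. by move=> [[h1 _] [h2 _]]. Qed.

Lemma CcC_bounded V : CcC V -> exists2 B, 0 < B & forall x, cabs (V x) <= B.
Proof.
have H f : Cc f -> exists2 B, 0 < B & forall x, `|f x| <= B.
  move=> [fc [M f0]].
  have cK := @compact_closed_ball R d (M).
  have [B0 [_ hB]] := compact_bounded (continuous_compact (continuous_subspaceT fc) cK).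
  exists (`|B0| + 1); first by rewrite ltr_wpDl.
  move=> x; have [xM|xM] := leP `|x| M; last by rewrite f0 // normr0 addr_ge0.
  by apply: (hB (`|B0| + 1)); [have := ler_norm B0; lra|exists x].
move=> [/H[B1 B10 h1] /H[B2 B20 h2]]; exists (B1 + B2); first exact: addr_gt0.
move=> x; apply: le_trans (cabs_le _) _; exact: lerD.
Qed.

Lemma cint_lin c V W : CcC V -> CcC W ->
  cint (fun x => c * V x + W x) = c * cint V + cint W.
Proof.
move=> [V1 V2] [W1 W2]; apply: complex_ext.
  rewrite ReD ReM /cint /=.
  rewrite (_ : (fun _ => _) = fun x => Re c * Re (V x) + ((- Im c) * Im (V x) + Re (W x))).
    by rewrite !integral_lin //; [ring|exact: Cc_lin].
  by apply/funext => x; rewrite ReD ReM; ring.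
rewrite ImD ImM /cint /=.
rewrite (_ : (fun _ => _) = fun x => Re c * Im (V x) + (Im c * Re (V x) + Im (W x))).
  by rewrite !integral_lin //; [ring|exact: Cc_lin].
by apply/funext => x; rewrite ImD ImM; ring.
Qed.

Lemma cint0 : cint (fun _ : pt => 0 : C) = 0.
Proof.
have E := cint_lin (-1) CcC0 CcC0.
transitivity (cint (fun _ : pt => (-1 : C) * 0 + 0)); first by rewrite mulr0 addr0.
by rewrite E; ring.
Qed.

Lemma cintZ c V : CcC V -> cint (fun x => c * V x) = c * cint V.
Proof.
move=> cV; have := cint_lin c cV CcC0; rewrite cint0 addr0 => <-.
by congr cint; apply/funext => x; rewrite addr0.
Qed.

Lemma cint_bound M V B : 0 <= M -> contC V -> (forall x, M < `|x| -> V x = 0) ->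
  (forall x, cabs (V x) <= B) -> cabs (cint V) <= 2 * (2 * M) ^+ d * B.
Proof.
move=> M0 [V1 V2] V0 VB; apply: le_trans (cabs_le _) _ => /=.
rewrite -mulrA mulr_natl mulr2n; apply: lerD; apply: integral_bound => //.
- by move=> x /V0 ->.
- move=> x; exact: le_trans (cabs_Re _) (VB x).
- by move=> x /V0 ->.
- move=> x; exact: le_trans (cabs_Im _) (VB x).
Qed.

Lemma testfunP phi : testfun setT phi <->
  smoothC setT phi /\ exists M, forall x, M < `|x| -> phi x = 0.
Proof.
split=> [[phis [K [Kc _ K0]]]|[phis [M M0]]]; split => //.
  have [M [_ hM]] := compact_bounded Kc.
  exists (M + 1) => x lt; apply: K0 => Kx; move: lt; rewrite ltNge => /negP; apply.
  by apply: hM => //; rewrite ltrDl.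
exists [set x : pt | `|x| <= M]; split => //.
  exact: compact_closed_ball.
by move=> x /= /negP; rewrite -ltNge; exact: M0.
Qed.

Lemma testfun0 : testfun setT (fun _ : pt => 0 : C).
Proof.
apply/testfunP; split; last by exists 0.
by split; apply: fexp_alg_smooth; exact: fa_cst.
Qed.

Lemma pdlC_Re l phi : (fun x => Re (pdlC l phi x)) = pdl l (fun x => Re (phi x)).
Proof. by elim: l => [//|i l IH]; apply/funext => x /=; rewrite IH. Qed.

Lemma pdlC_Im l phi : (fun x => Im (pdlC l phi x)) = pdl l (fun x => Im (phi x)).
Proof. by elim: l => [//|i l IH]; apply/funext => x /=; rewrite IH. Qed.

Lemma pdlC_CcC l phi : testfun setT phi -> CcC (pdlC l phi).
Proof.
move=> /testfunP[[s1 s2] [M M0]]; split; rewrite ?pdlC_Re ?pdlC_Im; split.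
- exact/smoothR_cont/smoothR_pdl.
- by exists M; apply: pdl_support => x /M0 ->.
- exact/smoothR_cont/smoothR_pdl.
- by exists M; apply: pdl_support => x /M0 ->.
Qed.

Lemma testfun_CcC phi : testfun setT phi -> CcC phi.
Proof. exact: (@pdlC_CcC [::]). Qed.

(** A word representing the multi-index, so that results on iterated derivatives along lists apply
    to [dmulti]. *)
Definition blist (b : 'I_d -> nat) : seq 'I_d := flatten [seq nseq (b i) i | i <- enum 'I_d].

Lemma dmultiE b phi : dmulti b phi = pdlC (blist b) phi.
Proof.
rewrite /dmulti /blist /pdlC; elim: (enum _) => [//|i l IH] /=.
rewrite foldr_cat -IH; elim: (b i) => [//|n IHn] /=; by rewrite IHn.
Qed.

Lemma prod_blist b r : \prod_(i <- blist b) r i = \prod_i r i ^+ b i.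
Proof.
rewrite /blist big_flatten big_map big_enum /=; apply: eq_bigr => i _.
by rewrite big_nseq; elim: (b i) => [//|n IH] /=; rewrite exprS IH.
Qed.

Lemma pdlC_affm c p r l phi : smoothC setT phi ->
  pdlC l (fun y => c%:C * phi (affm p r y)) =
  (fun y => (c * \prod_(i <- l) r i)%:C * pdlC l phi (affm p r y)).
Proof.
move=> [s1 s2]; apply/funext => y; apply: complex_ext.
  have /(congr1 (fun F => F y)) /= -> := pdlC_Re l (fun y => c%:C * phi (affm p r y)).
  rewrite (_ : (fun x => _) = fun x => c * (fun u => Re (phi u)) (affm p r x)).
    by rewrite (pdl_affm (f := fun u => Re (phi u))) // ReZ -pdlC_Re.
  by apply/funext => x; rewrite ReZ.
have /(congr1 (fun F => F y)) /= -> := pdlC_Im l (fun y => c%:C * phi (affm p r y)).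
rewrite (_ : (fun x => _) = fun x => c * (fun u => Im (phi u)) (affm p r x)).
  by rewrite (pdl_affm (f := fun u => Im (phi u))) // ImZ -pdlC_Im.
by apply/funext => x; rewrite ImZ.
Qed.

Lemma testfun_affm c p r phi : (forall i, 0 < r i) -> testfun setT phi ->
  testfun setT (fun y => c%:C * phi (affm p r y)).
Proof.
move=> r0 /testfunP[[s1 s2] [M M0]]; apply/testfunP; split.
  split.
    rewrite (_ : (fun x => _) = fun x => c * (fun u => Re (phi u)) (affm p r x)).
      exact: (smoothR_affm (f := fun u => Re (phi u))).
    by apply/funext => x; rewrite ReZ.
  rewrite (_ : (fun x => _) = fun x => c * (fun u => Im (phi u)) (affm p r x)).
    exact: (smoothR_affm (f := fun u => Im (phi u))).
  by apply/funext => x; rewrite ImZ.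
(* Once |x_j| exceeds [N j], the j-th coordinate of the image exceeds [M] in modulus. The sum of the
   [N j] is a radius valid for every coordinate. *)
pose N j := (`|M| + `|p 0 j|) / r j.
have N0 j : 0 <= N j by rewrite divr_ge0 ?addr_ge0 // ltW.
exists (\sum_j N j) => x lt.
have [i hi] : exists i, \sum_j N j < `|x 0 i|.
  apply: contrapT => H; move: lt; rewrite ltNge => /negP; apply.
  apply: normrV_le; first exact: sumr_ge0.
  by move=> i; rewrite leNgt; apply/negP => h; apply: H; exists i.
rewrite M0 ?mulr0 //; apply: lt_le_trans (normrV_ge _ i); rewrite mxE.
have h1 : N i < `|x 0 i|.
  by apply: le_lt_trans hi; rewrite (bigD1 i) //= lerDl; exact: sumr_ge0.
have h2 : `|M| + `|p 0 i| < r i * `|x 0 i| by rewrite mulrC -ltr_pdivrMr.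
have := ler_normB (p 0 i + r i * x 0 i) (p 0 i).
rewrite addrAC subrr add0r normrM (gtr0_norm (r0 i)); have := ler_norm M; lra.
Qed.

Definition invr_affm p r : pt := \row_i (- (p 0 i / r i)).

Lemma affmK p r y : (forall i, 0 < r i) ->
  affm (invr_affm p r) (fun i => (r i)^-1) (affm p r y) = y.
Proof.
move=> r0; apply/rowP => i; rewrite !mxE; field; exact: lt0r_neq0.
Qed.

Lemma cint_affm V p r : (forall i, 0 < r i) -> CcC V ->
  cint (fun y => V (affm p r y)) = (\prod_i (r i)^-1)%:C * cint V.
Proof.
move=> r0 [V1 V2]; apply: complex_ext; rewrite ?ReZ ?ImZ /cint /=.
  by rewrite (integral_affm p r0 V1).
by rewrite (integral_affm p r0 V2).
Qed.

Lemma contC_affm V p r : contC V -> contC (fun y => V (affm p r y)).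
Proof.
move=> [V1 V2]; split => x.
  by apply: (@continuous_comp _ _ _ (affm p r) (fun x => Re (V x))); [exact: affm_cont|exact: V1].
by apply: (@continuous_comp _ _ _ (affm p r) (fun x => Im (V x))); [exact: affm_cont|exact: V2].
Qed.

(** Real bumps separate real and imaginary parts. A continuous real function positive at a point is
    positive on a small ball, and its integral against a bump supported there is positive; applied
    to both differences this gives equality. *)
Lemma fundamental_lemma V W : contC V -> contC W ->
  (forall phi, testfun setT phi -> cint (fun y => V y * phi y) = cint (fun y => W y * phi y)) ->
  V = W.
Proof.
move=> [V1 V2] [W1 W2] H.
have bump_test b M x0 : smoothR setT b -> (forall x, M < `|x - x0| -> b x = 0) ->
    testfun setT (fun x : pt => (b x)%:C) /\ Cc b.
  move=> bs b0.
  have bM : forall x : pt, M + `|x0| < `|x| -> b x = 0.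
    move=> x lt; apply: b0; have := ler_normD (x - x0) x0; rewrite subrK; lra.
  split; last by split; [exact: smoothR_cont|exists (M + `|x0|)].
  apply/testfunP; split; last by exists (M + `|x0|) => x /bM ->.
  split; [exact: bs|apply: fexp_alg_smooth; exact: fa_cst].
have F (h : pt -> R) : continuous h ->
    (forall b, smoothR setT b -> (exists M x0, forall x, M < `|x - x0| -> b x = 0) ->
      Defs.integral (fun y => h y * b y) = 0) -> forall x, h x <= 0.
  move=> hc hb x0; rewrite leNgt; apply/negP => hx0.
  have [r r0 hr] : exists2 r : R, 0 < r & forall x, `|x0 - x| <= r -> 0 < h x.
    have /cvgr_gt/(_ _ hx0)/nbhs_ballP[r /= r0 hr] := hc x0.
    exists (r / 2); first by rewrite divr_gt0.
    move=> x lt; apply: hr; rewrite -ball_normE /=; lra.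
  have [b [bs b0 bx bsupp]] := bump_exists x0 r0.
  have E := hb b bs (ex_intro _ r (ex_intro _ x0 bsupp)).
  have [_ bC] := bump_test b r x0 bs bsupp.
  suff : 0 < Defs.integral (fun y => h y * b y) by rewrite E ltxx.
  apply: (integral_gt0 (x := x0)).
  - exact: Cc_mul.
  - move=> y; have [le|lt] := leP `|x0 - y| r; first by rewrite mulr_ge0 // ltW // hr.
    by rewrite bsupp ?mulr0 // distrC.
  - by rewrite mulr_gt0.
have G (h1 h2 : pt -> R) : continuous h1 -> continuous h2 ->
    (forall b, smoothR setT b -> (exists M x0, forall x, M < `|x - x0| -> b x = 0) ->
      Defs.integral (fun y => h1 y * b y) = Defs.integral (fun y => h2 y * b y)) -> h1 = h2.
  move=> c1 c2 E.
  have K (k1 k2 : pt -> R) : continuous k1 -> continuous k2 ->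
    (forall b, smoothR setT b -> (exists M x0, forall x, M < `|x - x0| -> b x = 0) ->
      Defs.integral (fun y => k1 y * b y) = Defs.integral (fun y => k2 y * b y)) -> forall x, k1 x <= k2 x.
    move=> d1 d2 E2 x; rewrite -subr_le0 addrC -mulN1r.
    apply: (F (fun x => -1 * k2 x + k1 x)).
      by apply: contD => //; apply: contM => //; exact: cont_cst.
    move=> b bs [M [x0 b0]]; have [_ bC] := bump_test b M x0 bs b0.
    rewrite (_ : (fun _ => _) = fun y => -1 * (k2 y * b y) + k1 y * b y); last first.
      by apply/funext => y; ring.
    rewrite integral_lin; [|exact: Cc_mul|exact: Cc_mul].
    by rewrite E2 //; [ring|exists M, x0].
  apply/funext => x; apply/eqP; rewrite eq_le !K // => b bs [M [x0 b0]].
  by rewrite E //; exists M, x0.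
have HR b : smoothR setT b -> (exists M x0, forall x, M < `|x - x0| -> b x = 0) ->
    cint (fun y => V y * (b y)%:C) = cint (fun y => W y * (b y)%:C).
  by move=> bs [M [x0 b0]]; have [bt _] := bump_test b M x0 bs b0; exact: H.
have E1 : (fun x => Re (V x)) = (fun x => Re (W x)).
  apply: G => // b bs bM; have := congr1 (fun z : C => Re z) (HR b bs bM).
  rewrite /cint /=.
  have EF (U : pt -> C) : (fun y => Re (U y * (b y)%:C)) = (fun y => Re (U y) * b y).
    by apply/funext => y; rewrite ReM /=; ring.
  by rewrite (EF V) (EF W).
have E2 : (fun x => Im (V x)) = (fun x => Im (W x)).
  apply: G => // b bs bM; have := congr1 (fun z : C => Im z) (HR b bs bM).
  rewrite /cint /=.
  have EF (U : pt -> C) : (fun y => Im (U y * (b y)%:C)) = (fun y => Im (U y) * b y).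
    by apply/funext => y; rewrite ImM /=; ring.
  by rewrite (EF V) (EF W).
apply/funext => x; apply: complex_ext; first exact: (congr1 (fun F => F x) E1).
exact: (congr1 (fun F => F x) E2).
Qed.

(** A continuous function is a distribution of order 0: the constant is the volume factor of
    [cint_bound] times a bound of |V| on a ball containing K. *)
Lemma distribution_cont V : contC V -> Defs.distribution setT (fun phi => cint (fun y => V y * phi y)).
Proof.
move=> cV; split.
  move=> c phi psi /testfun_CcC p1 /testfun_CcC p2.
  rewrite -cint_lin; [|exact: CcC_mul|exact: CcC_mul].
  by congr cint; apply/funext => y; ring.
move=> K Kc _; have [M0 [_ hM]] := compact_bounded Kc.
pose M := `|M0| + 1.
have KM x : K x -> `|x| <= M by apply: hM; have := ler_norm M0; rewrite /M; lra.
have cVK : exists2 B, 0 <= B & forall x, `|x| <= M -> cabs (V x) <= B.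
  have cK := @compact_closed_ball R d (M).
  have [B1 [_ h1]] := compact_bounded (continuous_compact (continuous_subspaceT cV.1) cK).
  have [B2 [_ h2]] := compact_bounded (continuous_compact (continuous_subspaceT cV.2) cK).
  exists ((`|B1| + 1) + (`|B2| + 1)); first by rewrite !addr_ge0.
  move=> x xM; apply: le_trans (cabs_le _) _; apply: lerD.
    by apply: (h1 (`|B1| + 1)); [have := ler_norm B1; lra|exists x].
  by apply: (h2 (`|B2| + 1)); [have := ler_norm B2; lra|exists x].
have [B B0 VB] := cVK.
exists (2 * (2 * M) ^+ d * B), 0%N => phi tphi phi0 N phiN.
have NP x : cabs (phi x) <= N by exact: (phiN [::]).
have zero x : M < `|x| -> phi x = 0.
  by move=> lt; apply: phi0 => /KM; rewrite leNgt lt.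
have M0' : 0 <= M by rewrite addr_ge0.
have cVp : contC (fun y => V y * phi y) by exact/CcC_cont/CcC_mul/testfun_CcC.
rewrite -[X in _ <= X]mulrA; refine (cint_bound M0' cVp _ _).
- by move=> x /zero ->; rewrite mulr0.
- move=> x; rewrite cabsM; have [le|lt] := leP `|x| M.
    by apply: ler_pM; rewrite ?cabs_ge0 // VB.
  rewrite zero // cabs0 mulr0 mulr_ge0 //; apply: le_trans (NP 0); exact: cabs_ge0.
Qed.

End TestFun.

(** * Continuous solutions of L V = 0 *)

Section Solutions.
Context {R : realType} {d : nat}.
Variables (s : 'I_d -> nat) (m : nat) (a : {ffun 'I_d -> 'I_m.+1} -> R[i]).
Notation pt := 'rV[R]_d.
Notation C := R[i].
Notation Re := complex.Re.
Notation Im := complex.Im.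
Implicit Types (V W phi psi : pt -> C) (f g : pt -> R) (p x : pt).

Definition dil (lam : R) (i : 'I_d) : R := lam ^+ s i.

Lemma dil_gt0 lam i : 0 < lam -> 0 < dil lam i.
Proof. by move=> h; rewrite exprn_gt0. Qed.

Lemma LT_CcC phi : testfun setT phi -> CcC (LT s a phi).
Proof.
move=> tphi; rewrite /LT.
elim: (index_enum _) => [|b r IH].
  by rewrite (_ : (fun _ => _) = fun=> 0); [exact: CcC0|apply/funext => x; rewrite big_nil].
pose P b := sdeg s (fun i : 'I_d => (b : {ffun 'I_d -> 'I_m.+1}) i : nat) == m.
have [Pb|Pb] := boolP (P b).
  rewrite (_ : (fun _ => _) = fun x => (a b * (-1) ^+ (\sum_i (b i : nat))) * dmulti (fun i => b i : nat) phi x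
     + \sum_(b0 <- r | P b0) a b0 * (-1) ^+ (\sum_i (b0 i : nat)) * dmulti (fun i => b0 i : nat) phi x).
    by apply: CcC_lin => //; rewrite dmultiE; exact: pdlC_CcC.
  by apply/funext => x; rewrite big_cons -/(P b) Pb.
rewrite (_ : (fun _ => _) = fun x => \sum_(b0 <- r | P b0) a b0 * (-1) ^+ (\sum_i (b0 i : nat)) * dmulti (fun i => b0 i : nat) phi x) //.
by apply/funext => x; rewrite big_cons -/(P b) (negbTE Pb).
Qed.

Lemma dmulti_dil (c : R) p lam b phi : smoothC setT phi ->
  dmulti b (fun y => c%:C * phi (affm p (dil lam) y)) =
  (fun y => (c * lam ^+ sdeg s b)%:C * dmulti b phi (affm p (dil lam) y)).
Proof.
move=> sphi; rewrite !dmultiE pdlC_affm // prod_blist; apply/funext => y.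
congr ((c * _)%:C * _); rewrite /sdeg -prodrXr; apply: eq_bigr => i _.
by rewrite /dil exprM.
Qed.

(** Every multi-index in the sum has anisotropic degree exactly m, so a single power of [lam] comes
    out. *)
Lemma LT_dil (c : R) p lam phi : smoothC setT phi ->
  LT s a (fun y => c%:C * phi (affm p (dil lam) y)) =
  (fun y => (c * lam ^+ m)%:C * LT s a phi (affm p (dil lam) y)).
Proof.
move=> sphi; apply/funext => y; rewrite /LT mulr_sumr; apply: eq_bigr => b /eqP bm.
by rewrite dmulti_dil // bm mulrCA.
Qed.

Lemma rescaleE phi x (lam : R) : rescale s phi x lam =
  (fun y => (lam ^- (\sum_i s i))%:C * phi (affm (invr_affm x (dil lam)) (dil lam^-1) y)).
Proof.
apply/funext => y; rewrite /rescale; congr (_ * phi _).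
by apply/rowP => i; rewrite !mxE /dil exprVn; ring.
Qed.

Lemma rescale_testfun phi x (lam : R) : 0 < lam -> testfun setT phi ->
  testfun setT (rescale s phi x lam).
Proof.
move=> l0 t; rewrite rescaleE; apply: testfun_affm => // i.
by apply: dil_gt0; rewrite invr_gt0.
Qed.

(** The change of variables y -> x + lam^s y: blowing up the function amounts to rescaling the test
    function, and the homogeneity of L leaves the factor lam^m. *)
Lemma cint_blowup V phi x (lam : R) : 0 < lam -> contC V -> testfun setT phi ->
  cint (fun y => V (affm x (dil lam) y) * LT s a phi y) =
  (lam ^+ m)%:C * cint (fun y => V y * LT s a (rescale s phi x lam) y).
Proof.
move=> l0 cV tphi.
have r0 i : 0 < dil lam i by exact: dil_gt0.
have tr := rescale_testfun x l0 tphi.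
have cVr : CcC (fun y => V y * LT s a (rescale s phi x lam) y).
  by apply: CcC_mul => //; exact: LT_CcC.
rewrite rescaleE LT_dil in cVr *; last by have [] := tphi.
rewrite -cintZ //.
(* The factor that [LT_dil] extracts from [rescale]. Both sides are multiplied by it, so that the
   integrands agree after the substitution. *)
pose c := (lam ^- (\sum_i s i) * lam^-1 ^+ m).
have := cint_affm x r0 cVr.
rewrite cintZ // => E.
have c0 : c != 0 by rewrite mulf_neq0 // ?expf_neq0 ?invr_eq0 ?expf_neq0 // lt0r_neq0.
have cC0 : (c%:C : C) != 0 by rewrite eq_complex /= eqxx andbT.
apply: (mulfI cC0).
rewrite -(cintZ c%:C (V := fun y => V (affm x (dil lam) y) * LT s a phi y)); last first.
  by apply: CcC_mul; [exact: contC_affm|exact: LT_CcC].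
transitivity (cint (fun y => V (affm x (dil lam) y) * (c%:C * LT s a phi
    (affm (invr_affm x (dil lam)) (dil lam^-1) (affm x (dil lam) y))))).
  congr cint; apply/funext => y.
  rewrite (_ : affm (invr_affm _ _) _ _ = y); first by rewrite mulrCA.
  rewrite -[RHS](affmK x y r0); congr affm; apply/funext => i.
  by rewrite /dil exprVn.
rewrite E mulrA; congr (_ * _); rewrite -[RHS]rmorphM /=; congr (_%:C).
rewrite /c exprVn divfK ?expf_neq0 ?lt0r_neq0 //.
by rewrite -exprVn -prodrXr; apply: eq_bigr => i _; rewrite /dil exprVn.
Qed.

Definition sol V := contC V /\
  forall phi, testfun setT phi -> cint (fun y => V y * LT s a phi y) = 0.

Lemma sol_affm V x (lam : R) : 0 < lam -> sol V -> sol (fun y => V (affm x (dil lam) y)).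
Proof.
move=> l0 [cV V0]; split; first exact: contC_affm.
move=> phi tphi; rewrite cint_blowup // V0 ?mulr0 //; exact: rescale_testfun.
Qed.

Lemma contC_lin c V W : contC V -> contC W -> contC (fun x => c * V x + W x).
Proof.
move=> [V1 V2] [W1 W2]; split.
  rewrite (_ : (fun _ => _) = fun x => Re c * Re (V x) + ((- Im c) * Im (V x) + Re (W x))).
    by do 2 (apply: contD; first by apply: contM => //; exact: cont_cst).
  by apply/funext => x; rewrite ReD ReM; ring.
rewrite (_ : (fun _ => _) = fun x => Re c * Im (V x) + (Im c * Re (V x) + Im (W x))).
  by do 2 (apply: contD; first by apply: contM => //; exact: cont_cst).
by apply/funext => x; rewrite ImD ImM; ring.
Qed.

Lemma sol_lin c V W : sol V -> sol W -> sol (fun x => c * V x + W x).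
Proof.
move=> [cV V0] [cW W0]; split; first exact: contC_lin.
move=> phi tphi; have L := LT_CcC tphi.
rewrite (_ : (fun _ => _) = fun y => c * (V y * LT s a phi y) + W y * LT s a phi y).
  by rewrite cint_lin; [rewrite V0 // W0 // mulr0 addr0|exact: CcC_mul|exact: CcC_mul].
by apply/funext => y; ring.
Qed.

Lemma sol0 : sol (fun=> 0).
Proof.
split; first by split; exact: cont_cst.
move=> phi _; rewrite (_ : (fun _ => _) = fun=> 0); first exact: cint0.
by apply/funext => y; rewrite mul0r.
Qed.

Lemma locally_uniform_continuous f :
  (forall r e : R, 0 < e -> exists g, continuous g /\ forall x, `|x| <= r -> `|f x - g x| <= e) ->
  continuous f.
Proof.
move=> H x; suff K : forall e : R, 0 < e -> \forall y \near (x : pt), `|f x - f y| <= e.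
  by move/cvgrPdist_le : K; exact.
move=> e e0; have [|g [gc hg]] := H (`|x| + 1) (e / 3); first by rewrite divr_gt0.
have /cvgrPdist_le/(_ (e / 3)) := gc x; rewrite divr_gt0 // => /(_ isT) gx.
near=> y.
have h1 : `|f x - g x| <= e / 3 by apply: hg; rewrite lerDl.
have h2 : `|f y - g y| <= e / 3.
  apply: hg; apply: (@le_trans _ _ (`|x| + `|x - y|)).
    by have := ler_normB x (x - y); rewrite opprB addrCA subrr addr0.
  by rewrite lerD2l; near: y; apply: cvgr_dist_le; [exact: cvg_id|].
have h3 : `|g x - g y| <= e / 3 by near: y.
rewrite (_ : f x - f y = (f x - g x) + (g x - g y) - (f y - g y)); last by ring.
have := ler_normB ((f x - g x) + (g x - g y)) (f y - g y).
have := ler_normD (f x - g x) (g x - g y); lra.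
Unshelve. all: by end_near. Qed.

(** The approximant may depend on the test function, and it need only be an approximate solution.
    This covers both exact solutions converging in weighted norm and blow-up sequences, whose defect
    is small only for each fixed test function. *)
Lemma sol_closed V :
  (forall (r e : R) phi, 0 < e -> testfun setT phi -> exists W,
     [/\ contC W, (forall x, `|x| <= r -> cabs (V x - W x) <= e) &
         cabs (cint (fun y => W y * LT s a phi y)) <= e]) -> sol V.
Proof.
move=> H; have t0 := @testfun0 R d.
have cV : contC V.
  split; apply: locally_uniform_continuous => r e e0;
    have [W [[W1 W2] h _]] := H r e _ e0 t0.
    exists (fun x => Re (W x)); split => // x /h; apply: le_trans.
    by have := cabs_Re (V x - W x); rewrite ReD; case: (W x).
  exists (fun x => Im (W x)); split => // x /h; apply: le_trans.
  by have := cabs_Im (V x - W x); rewrite ImD; case: (W x).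
split => // phi tphi; have L := LT_CcC tphi.
have [B B0 hB] := CcC_bounded L.
have [M M0 LM] : exists2 M, 0 <= M & forall x, M < `|x| -> LT s a phi x = 0.
  have [[_ [M1 h1]] [_ [M2 h2]]] := L; exists (`|M1| + `|M2|); first exact: addr_ge0.
  move=> x lt; apply: complex_ext.
    apply: h1; apply: le_lt_trans lt; have := ler_norm M1; have := normr_ge0 M2; lra.
  apply: h2; apply: le_lt_trans lt; have := ler_norm M2; have := normr_ge0 M1; lra.
(* Replacing [V] by [W] costs (K - 1) e/K, and the defect of [W] costs e/K, in total e. *)
pose K := 2 * (2 * M) ^+ d * B + 1.
have K0 : 0 < K by rewrite ltr_wpDl // mulr_ge0 ?(ltW B0) // mulr_ge0 // exprn_ge0 // mulr_ge0.
apply: cabs_eq0; apply/ler_addgt0Pr => e e0; rewrite add0r.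
have [|W [cW hW cW0]] := H M (e / K) phi _ tphi; first by rewrite divr_gt0.
have cD : contC (fun y => (-1) * W y + V y) by exact: contC_lin.
have -> : cint (fun y => V y * LT s a phi y) =
   1 * cint (fun y => ((-1) * W y + V y) * LT s a phi y) + cint (fun y => W y * LT s a phi y).
  rewrite -cint_lin; [|exact: CcC_mul|exact: CcC_mul].
  by congr cint; apply/funext => y; ring.
rewrite mul1r; apply: le_trans (cabsD _ _) _.
have : cabs (cint (fun y => ((-1) * W y + V y) * LT s a phi y)) <= 2 * (2 * M) ^+ d * (e / K * B).
  apply: cint_bound => //.
  - exact/CcC_cont/CcC_mul.
  - by move=> x /LM ->; rewrite mulr0.
  - move=> x; rewrite cabsM; have [le|lt] := leP `|x| M.
      by apply: ler_pM; rewrite ?cabs_ge0 // mulN1r addrC; exact: hW.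
    by rewrite LM // cabs0 mulr0 mulr_ge0 // ?ltW // divr_gt0.
have -> : 2 * (2 * M) ^+ d * (e / K * B) = e / K * (K - 1) by rewrite /K; ring.
have eK : e / K * K = e by rewrite divfK // lt0r_neq0.
move: cW0; rewrite mulrBr eK mulr1; lra.
Qed.

(** Ellipticity only yields a smooth function defining the same distribution; the fundamental lemma
    identifies it with [V] pointwise. *)
Lemma sol_smooth V : elliptic s a -> sol V -> smoothC setT V.
Proof.
move=> hL [cV V0].
have [|g [gs hg]] := hL setT openT _ (distribution_cont cV).
  exists (fun=> 0); split; first by split; apply: fexp_alg_smooth; exact: fa_cst.
  move=> phi tphi; rewrite V0 //; rewrite (_ : (fun _ => _) = fun=> 0) ?cint0 //.
  by apply/funext => y; rewrite mul0r.
rewrite (fundamental_lemma cV _ hg) //.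
by have [g1 g2] := gs; split; [exact: (smoothR_cont g1)|exact: (smoothR_cont g2)].
Qed.

End Solutions.

(** * Uniform boundedness *)

Section Weighted.
Context {R : realType} {d : nat} (N : nat).
Notation pt := 'rV[R]_d.
Notation C := R[i].
Notation Re := complex.Re.
Notation Im := complex.Im.
Implicit Types (V W : pt -> C) (x y : pt) (M : R).

Definition weight y : R := (1 + `|y|) ^+ N.

Lemma weight_gt0 y : 0 < weight y.
Proof. by rewrite exprn_gt0 // ltr_wpDr. Qed.

Lemma weight_mono y r : `|y| <= r -> weight y <= (1 + r) ^+ N.
Proof.
move=> h; have r0 := le_trans (normr_ge0 _) h.
by apply: lerXn2r; rewrite ?nnegrE ?addr_ge0 // lerD2l.
Qed.

Definition wbound V M := forall y, cabs (V y) <= M * weight y.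

Lemma wbound_ge0 V M : wbound V M -> 0 <= M.
Proof.
move=> /(_ 0) h; have := le_trans (cabs_ge0 _) h.
by rewrite pmulr_lge0 // weight_gt0.
Qed.

Lemma wboundD V W M K (c : R) : wbound V M -> wbound W K ->
  wbound (fun y => c%:C * V y + W y) (`|c| * M + K).
Proof.
move=> hV hW y; apply: le_trans (cabsD _ _) _; rewrite mulrDl; apply: lerD => //.
by rewrite cabsM cabsR -mulrA ler_wpM2l.
Qed.

(** The tail of the geometric series of ratio 1/9 after k is 9^-k / 8. With this radius e_k the
    intervals [r_k - e_k, r_k + e_k] are nested, and the supremum of the left ends lies in all of
    them. *)
Lemma geometric_limit (r : nat -> R) (c : R) : 0 <= c ->
  (forall k, `|r k.+1 - r k| <= c * 9^-1 ^+ k.+1) ->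
  exists l, forall k, `|l - r k| <= c * 9^-1 ^+ k / 8.
Proof.
move=> c0 hr; pose e k : R := c * 9^-1 ^+ k / 8.
have eS k : e k = c * 9^-1 ^+ k.+1 + e k.+1 by rewrite /e exprS; field.
have e0 k : 0 <= e k by rewrite !mulr_ge0 ?exprn_ge0.
pose A := [set r k - e k | k in setT].
have mono j k : r j - e j <= r (j + k)%N - e (j + k)%N.
  elim: k => [|k IH]; first by rewrite addn0.
  apply: le_trans IH _; rewrite addnS eS.
  have := hr (j + k)%N; rewrite ler_norml; lra.
have mono2 j k : r (j + k)%N + e (j + k)%N <= r j + e j.
  elim: k => [|k IH]; first by rewrite addn0.
  apply: le_trans IH; rewrite addnS [in leRHS]eS.
  have := hr (j + k)%N; rewrite ler_norml; lra.
have ub k : ubound A (r k + e k).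
  move=> _ [j _ <-]; apply: le_trans (mono j k) _.
  rewrite addnC; apply: le_trans (mono2 k j); have := e0 (k + j)%N; lra.
have hA : has_sup A by split; [exists (r 0%N - e 0%N), 0%N|exists (r 0%N + e 0%N)].
exists (sup A) => k; rewrite -/(e k) ler_norml.
have h1 : r k - e k <= sup A by apply: sup_upper_bound => //; exists k.
have h2 : sup A <= r k + e k by apply: ge_sup; [exact: hA.1|exact: ub].
lra.
Qed.

Lemma wbound_limit (x : nat -> pt -> C) :
  (forall k, wbound (fun y => x k.+1 y - x k y) (9^-1 ^+ k.+1)) ->
  exists V, forall k, wbound (fun y => V y - x k y) (9^-1 ^+ k / 4).
Proof.
move=> hx.
have P y : exists z : C, forall k, cabs (z - x k y) <= 9^-1 ^+ k / 4 * weight y.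
  have w0 := ltW (weight_gt0 y).
  have [l hl] : exists l, forall k, `|l - Re (x k y)| <= weight y * 9^-1 ^+ k / 8.
    apply: geometric_limit => // k; rewrite mulrC; apply: le_trans (hx k y).
    by have := cabs_Re (x k.+1 y - x k y); rewrite ReD; case: (x k y).
  have [l' hl'] : exists l, forall k, `|l - Im (x k y)| <= weight y * 9^-1 ^+ k / 8.
    apply: geometric_limit => // k; rewrite mulrC; apply: le_trans (hx k y).
    by have := cabs_Im (x k.+1 y - x k y); rewrite ImD; case: (x k y).
  exists (l +i* l') => k; apply: le_trans (cabs_le _) _.
  rewrite ReD ImD /=; have := hl k; have := hl' k.
  rewrite (_ : Re (- x k y) = - Re (x k y)); last by case: (x k y).
  rewrite (_ : Im (- x k y) = - Im (x k y)); last by case: (x k y).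
  lra.
have [V hV] := choice P.
by exists V => k y; exact: hV.
Qed.

(* Sokal's elementary proof of the uniform boundedness principle. *)
Lemma uniform_boundedness (X : (pt -> C) -> Prop) (T : nat -> (pt -> C) -> R) :
  X (fun=> 0) ->
  (forall (c : R) V W, X V -> X W -> X (fun y => c%:C * V y + W y)) ->
  (forall (x : nat -> pt -> C) V, (forall k, X (x k)) ->
     (forall k, wbound (fun y => V y - x k y) (9^-1 ^+ k / 4)) -> X V) ->
  (forall n (c : R) V W, X V -> X W -> T n (fun y => c%:C * V y + W y) = c * T n V + T n W) ->
  (forall n, exists B, forall V M, X V -> wbound V M -> `|T n V| <= B * M) ->
  (forall V, X V -> exists B, forall n, `|T n V| <= B) ->
  exists B, forall n V M, X V -> wbound V M -> `|T n V| <= B * M.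
Proof.
move=> X0 Xl Xc Tl Tb Tp; apply: contrapT => H.
have T0 n : T n (fun=> 0) = 0.
  have := Tl n (-1) _ _ X0 X0; rewrite mulN1r addNr => <-.
  by congr T; apply/funext => y; rewrite mulr0 addr0.
have TZ n (c : R) V : X V -> T n (fun y => c%:C * V y) = c * T n V.
  move=> XV; have := Tl n c _ _ XV X0; rewrite T0 addr0 => <-.
  by congr T; apply/funext => y; rewrite addr0.
have XZ (c : R) V : X V -> X (fun y => c%:C * V y).
  move=> XV; have := Xl c _ _ XV X0.
  by congr X; apply/funext => y; rewrite addr0.
have big (B : R) : exists n V, [/\ X V, wbound V 1 & B < `|T n V|].
  apply: contrapT => K; apply: H; exists `|B| => n V M XV hV.
  have M0 := wbound_ge0 hV.
  have [K' hK'] := Tb n.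
  rewrite le_eqVlt in M0; case/predU1P: M0 => M0.
    by have := hK' V M XV hV; rewrite -M0 !mulr0.
  rewrite leNgt; apply/negP => lt; apply: K; exists n, (fun y => (M^-1)%:C * V y); split.
  - exact: XZ.
  - move=> y; rewrite cabsM cabsR gtr0_norm ?invr_gt0 // ler_pdivrMl // mul1r; exact: hV.
  - rewrite TZ // normrM gtr0_norm ?invr_gt0 // ltr_pdivlMl // mulrC.
    by apply: le_lt_trans lt; apply: ler_wpM2r; [exact: ltW|exact: ler_norm].
have pick (k : nat) : exists nu : nat * (pt -> C), [/\ X nu.2, wbound nu.2 1,
    k%:R * 9 ^+ k.+1 * 4 < `|T nu.1 nu.2| &
    forall W M, X W -> wbound W M -> `|T nu.1 W| <= 3 / 2 * `|T nu.1 nu.2| * M].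
  pose B : R := k%:R * 9 ^+ k.+1 * 4.
  have B0 : 0 <= B by rewrite !mulr_ge0 // exprn_ge0.
  (* [u] below reaches at least 2/3 of the operator norm of [T n]; starting above 3/2 B therefore
     keeps |T n u| above B. *)
  have [n [V0 [XV0 V01 hV0]]] := big (3 / 2 * B).
  pose S := [set `|T n V| | V in [set V | X V /\ wbound V 1]].
  have [K hK] := Tb n.
  have hS : has_sup S.
    split; first by exists `|T n V0|, V0.
    by exists (K * 1) => _ [V [XV V1] <-]; exact: hK.
  have s1 : `|T n V0| <= sup S by apply: sup_upper_bound => //; exists V0.
  have s0 : 0 < sup S by apply: le_lt_trans (lt_le_trans hV0 s1); rewrite mulr_ge0 // divr_ge0.
  have [|_ [u [Xu u1] <-] hu] := @sup_adherent _ S (sup S / 3) _ hS; first by rewrite divr_gt0.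
  exists (n, u); split => //=; first by rewrite -/B; lra.
  move=> W M XW hW; have M0 := wbound_ge0 hW.
  apply: (@le_trans _ _ (sup S * M)); last by apply: ler_wpM2r => //; lra.
  rewrite le_eqVlt in M0; case/predU1P: M0 => M0.
    by have := hK W M XW hW; rewrite -M0 !mulr0.
  rewrite mulrC -ler_pdivrMl //; apply: sup_upper_bound => //; exists (fun y => (M^-1)%:C * W y).
    split; first exact: XZ.
    by move=> y; rewrite cabsM cabsR gtr0_norm ?invr_gt0 // ler_pdivrMl // mul1r; exact: hW.
  by rewrite TZ // normrM gtr0_norm // invr_gt0.
have [nu hnu] := choice pick.
pose n k := (nu k).1; pose u k := (nu k).2.
pose e k : R := 9^-1 ^+ k.+1.
have e0 k : 0 < e k by rewrite exprn_gt0.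
pose step (sg : R) k (v : pt -> C) : pt -> C := fun y => (sg * e k)%:C * u k y + v y.
(* The sign is chosen so that |T (x + e u)| or |T (x - e u)|, whichever is taken, is at least e |T
   u|: the difference of the two values is 2 e T u. *)
pose x := fix x k := if k is k'.+1 then
  (if e k' * `|T (n k') (u k')| <= `|T (n k') (step 1 k' (x k'))| then step 1 k' (x k')
   else step (-1) k' (x k')) else (fun _ : pt => 0 : C).
have xX k : X (x k).
  elim: k => [//|k IH] /=; have [Xu _ _ _] := hnu k.
  by case: ifP => _; exact: Xl.
have xS k : wbound (fun y => x k.+1 y - x k y) (9^-1 ^+ k.+1).
  have [_ u1 _ _] := hnu k.
  move=> y /=; case: ifP => _; rewrite addrK cabsM cabsR normrM (gtr0_norm (e0 k));
    rewrite ?normrN normr1 mul1r ler_wpM2l ?(ltW (e0 k)) //; have := u1 y; by rewrite mul1r.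
have xT k : e k * `|T (n k) (u k)| <= `|T (n k) (x k.+1)|.
  have [Xu _ _ _] := hnu k.
  rewrite /=; case: ifPn => // /negP; rewrite /step.
  rewrite !Tl //; have := e0 k.
  rewrite !mul1r mulN1r mulNr.
  set t := T _ (u k); set z := T _ (x k) => ek; move/negP; rewrite -ltNge.
  have := ler_normB (e k * t + z) (- (e k * t) + z).
  rewrite opprD opprK addrACA subrr addr0 -mulr2n -mulr_natl !normrM (ger0_norm (x := 2)) //.
  rewrite (gtr0_norm ek); lra.
have [V hV] := wbound_limit xS.
have XV := Xc _ _ xX hV.
have [B hB] := Tp V XV.
(* With t = |T u| at stage k, the limit [V] is within 9^-(k+1) / 4 of x_(k+1), which changes T by at
   most 3/2 * 1/4 = 3/8 of e_k t. Hence 5/8 of e_k t is at most B < k, against e_k t > 4k. *)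
pose k := Num.bound `|B : R|.
have [Xu u1 bu nb] := hnu k.
have D1 : X (fun y => (-1)%:C * x k.+1 y + V y) by exact: Xl.
have D2 : wbound (fun y => (-1)%:C * x k.+1 y + V y) (9^-1 ^+ k.+1 / 4).
  move=> y; have := hV k.+1 y; congr (cabs _ <= _).
  by rewrite rmorphN1 mulN1r addrC.
have := nb _ _ D1 D2; rewrite -/(n k) -/(u k) Tl // mulN1r.
have := xT k; have := hB (n k); rewrite -/(e k).
have kB : B < k%:R by apply: le_lt_trans (ler_norm _) (archi_boundP _).
set t := `|T (n k) (u k)| => h1 h2 h3.
have bu2 : k%:R * 4 < e k * t.
  rewrite /e exprVn -ltr_pdivrMl ?invr_gt0 ?exprn_gt0 // invrK.
  by apply: le_lt_trans bu; rewrite mulrCA mulrA.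
have h4 : `|T (n k) (x k.+1)| <= B + 3 / 8 * (e k * t).
  have -> : T (n k) (x k.+1) = T (n k) V - (- T (n k) (x k.+1) + T (n k) V) by ring.
  apply: le_trans (ler_normB _ _) _; apply: lerD => //; apply: le_trans h3 _.
  by rewrite -/(e k) le_eqVlt; apply/orP; left; apply/eqP; rewrite -/t; field.
have : 0 <= k%:R :> R by [].
lra.
Qed.

End Weighted.

(** * Liouville theorem *)

Section Liouville.
Context {R : realType} {d : nat}.
Variables (s : 'I_d -> nat) (m : nat) (a : {ffun 'I_d -> 'I_m.+1} -> R[i]).
Hypothesis (hs : forall i, (0 < s i)%N) (hL : elliptic s a).
Notation pt := 'rV[R]_d.
Notation C := R[i].
Notation Re := complex.Re.
Notation Im := complex.Im.
Implicit Types (V W phi psi : pt -> C) (f g : pt -> R) (p x y : pt) (l : seq 'I_d).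

Lemma dil1 : dil s (1 : R) = fun=> 1.
Proof. by apply/funext => i; rewrite /dil expr1n. Qed.

Lemma wbound_shift N V M p : wbound N V M ->
  wbound N (fun y => V (affm p (dil s 1) y)) (M * (1 + `|p|) ^+ N).
Proof.
move=> hV y; have M0 := wbound_ge0 hV; apply: le_trans (hV _) _.
rewrite -mulrA ler_wpM2l // -exprMn.
apply: lerXn2r; rewrite ?nnegrE ?mulr_ge0 ?addr_ge0 // dil1.
rewrite (_ : affm _ _ _ = p + y); last by apply/rowP => i; rewrite !mxE mul1r.
have := ler_normD p y; have := mulr_ge0 (normr_ge0 p) (normr_ge0 y); nra.
Qed.

Lemma quotient_limit f x (v : pt) : derivable f x v ->
  (fun n : nat => n.+1%:R * (f (n.+1%:R^-1 *: v + x) - f x)) @ \oo --> 'D_v f x.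
Proof.
move=> df; have c0 : (fun n : nat => n.+1%:R^-1 : R) @ \oo --> (0 : R)^'.
  move=> A /nbhs_ballP[e /= e0 hA].
  suff : \forall n \near \oo, A (n.+1%:R^-1) by [].
  have := near_infty_natSinv_lt (PosNum e0); apply: filterS => n /= hn.
  apply: hA; last by rewrite invr_eq0 pnatr_eq0.
  by rewrite -ball_normE /ball_ /= sub0r normrN gtr0_norm ?invr_gt0.
have := cvg_comp _ _ c0 df.
by apply: cvg_trans; apply: near_eq_cvg; near=> n; rewrite /= invrK.
Unshelve. all: by end_near. Qed.

(** Induction on the number of derivatives. For one more derivative, [T n] is a difference quotient
    of the previous one; the induction hypothesis at translated solutions makes each [T n] bounded,
    smoothness makes the sequence converge on each solution, and uniform boundedness gives a common
    constant that survives the limit. *)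
Lemma sol_derive_bound N l : exists B : R, forall V M, sol s a V -> wbound N V M ->
  `|pdl l (fun y => Re (V y)) 0| <= B * M.
Proof.
elim: l => [|i l [B IH]].
  exists 1 => V M _ hV; rewrite mul1r; apply: le_trans (cabs_Re _) _.
  by have := hV 0; rewrite /weight normr0 addr0 expr1n mulr1.
pose X V := sol s a V /\ exists M, wbound N V M.
pose g V := pdl l (fun y => Re (V y)).
pose T (n : nat) V : R := n.+1%:R * (g V (n.+1%:R^-1 *: evec R i + 0) - g V 0).
have sm V : sol s a V -> smoothR setT (fun y => Re (V y)).
  by move=> /(sol_smooth hL)[].
have gl (c : R) V W : sol s a V -> sol s a W ->
    g (fun y => c%:C * V y + W y) = fun y => c * g V y + g W y.
  move=> sV sW; rewrite /g -(pdl_lin _ _ (sm _ sV) (sm _ sW)); congr pdl.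
  by apply/funext => y; rewrite ReD ReZ.
have lim V : sol s a V -> (fun n => T n V) @ \oo --> pd i (g V) 0.
  move=> sV; apply: quotient_limit; apply: smoothR_derivable; apply: smoothR_pdl; exact: sm.
have gb V M x : sol s a V -> wbound N V M -> `|g V x| <= B * (M * (1 + `|x|) ^+ N).
  move=> sV hV; have := IH _ _ (sol_affm x ltr01 sV) (wbound_shift x hV).
  congr (`|_| <= _).
  have := pdl_affm 1 x (dil s 1) l (sm _ sV).
  rewrite (_ : (fun _ => _) = fun y => Re (V (affm x (dil s 1) y))); last first.
    by apply/funext => y; rewrite mul1r.
  move=> ->; rewrite mul1r dil1 big1 // mul1r; congr (g V _).
  by apply/rowP => j; rewrite !mxE mulr0 addr0.
have [] := @uniform_boundedness R d N X T.
- by split; [exact: sol0|exists 0 => y; rewrite cabs0 mul0r].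
- move=> c V W [sV [M hV]] [sW [K hW]]; split; first exact: sol_lin.
  by exists (`|c| * M + K); exact: wboundD.
- move=> x V hx hV; split; last first.
    have [_ [M hM]] := hx 0%N; exists (`|1| * (9^-1 ^+ 0 / 4) + M).
    move=> y; have := wboundD 1 (hV 0%N) hM y; congr (cabs _ <= _).
    by rewrite mul1r subrK.
  apply: sol_closed => r e phi e0 tphi.
  have W0 : 0 < (1 + `|r|) ^+ N by rewrite exprn_gt0 // ltr_wpDr.
  have [k hk] : exists k : nat, 9^-1 ^+ k / 4 * (1 + `|r|) ^+ N <= e.
    pose E := e / (1 + `|r|) ^+ N.
    have E0 : 0 < E by rewrite divr_gt0.
    exists (Num.bound E^-1); rewrite -ler_pdivlMr // -/E.
    set k := Num.bound _.
    have hk : E^-1 < k%:R by apply: archi_boundP; rewrite invr_ge0 ltW.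
    have h9 : k%:R <= 9 ^+ k :> R.
      by rewrite -natrX ler_nat ltnW // ltn_expl.
    rewrite exprVn; apply: (@le_trans _ _ (9 ^+ k)^-1).
      by rewrite ler_piMr ?invr_ge0 ?exprn_ge0 //; lra.
    by rewrite invf_ple ?posrE ?exprn_gt0 //; lra.
  have [[cx sx] _] := hx k; exists (x k); split => //; last by rewrite sx // cabs0 ltW.
  move=> y yr; apply: le_trans (hV k y) (le_trans _ hk).
  rewrite ler_wpM2l ?divr_ge0 ?exprn_ge0 //; apply: weight_mono.
  by apply: le_trans yr (ler_norm _).
- by move=> n c V W [sV _] [sW _]; rewrite /T gl //; ring.
- move=> n; pose h := n.+1%:R^-1 *: evec R i + 0.
  exists (n.+1%:R * (B * (1 + `|h|) ^+ N + B)) => V M [sV _] hV.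
  rewrite /T -/h normrM ger0_norm // -mulrA ler_wpM2l //.
  apply: le_trans (ler_normB _ _) _; rewrite mulrDl; apply: lerD.
    by rewrite -mulrA [_ * M]mulrC; exact: gb.
  by have := gb V M 0 sV hV; rewrite normr0 addr0 expr1n mulr1.
- move=> V [sV _].
  have /cvg_seq_bounded[B0 [_ hB]] : cvgn (fun n => T n V) by apply/cvg_ex; exists (pd i (g V) 0); exact: lim.
  by exists (B0 + 1) => n; apply: hB => //; rewrite ltrDl.
move=> B' hB'; exists B' => V M sV hV; rewrite -[pdl _ _]/(pd i (g V)).
apply/ler_addgt0Pr => e e0.
have /cvgrPdist_le/(_ e e0)[n _ hn] := lim V sV.
have h1 := hn n (leqnn n); have h2 := hB' n V M (conj sV (ex_intro _ M hV)) hV.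
have -> : pd i (g V) 0 = T n V + (pd i (g V) 0 - T n V) by ring.
by apply: le_trans (ler_normD _ _) _; apply: lerD.
Qed.

Definition wt l : nat := \sum_(i <- l) s i.

(** Translates and dilates of solutions are solutions, so one constant serves all [x] and [lam]; the
    chain rule contributes lam^(wt l). *)
Lemma sol_derive_scaled N l : exists2 B : R, 0 <= B & forall V M x (lam : R), 0 < lam -> sol s a V ->
  wbound N (fun y => V (affm x (dil s lam) y)) M ->
  lam ^+ wt l * `|pdl l (fun y => Re (V y)) x| <= B * M.
Proof.
have [B hB] := sol_derive_bound N l; exists `|B| => // V M x lam l0 sV hV.
have M0 := wbound_ge0 hV.
apply: (@le_trans _ _ (B * M)); last by rewrite ler_wpM2r // ler_norm.
apply: le_trans (hB _ _ (sol_affm x l0 sV) hV).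
have [s1 _] := sol_smooth hL sV.
have := pdl_affm 1 x (dil s lam) l s1.
rewrite (_ : (fun _ => _) = fun y => Re (V (affm x (dil s lam) y))); last first.
  by apply/funext => y; rewrite mul1r.
move=> ->; rewrite mul1r /dil prodrXr -/(wt l) normrM gtr0_norm ?exprn_gt0 //.
rewrite (_ : affm x _ 0 = x) //.
by apply/rowP => j; rewrite !mxE mulr0 addr0.
Qed.

(** * The anisotropic distance under dilations *)

Lemma powR_quasi_add (u v q : R) : 0 < q -> q <= 1 ->
  `|u + v| `^ q <= 2 * (`|u| `^ q + `|v| `^ q).
Proof.
move=> q0 q1; pose w := Num.max `|u| `|v|.
have w0 : 0 <= w by rewrite le_max normr_ge0.
apply: (@le_trans _ _ ((2 * w) `^ q)).
  apply: ge0_ler_powR; rewrite ?nnegrE ?mulr_ge0 ?(ltW q0) //.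
  have h1 : `|u| <= w by rewrite le_max lexx.
  have h2 : `|v| <= w by rewrite le_max lexx orbT.
  by have := ler_normD u v; lra.
rewrite powRM //; apply: ler_pM; rewrite ?powR_ge0 //.
  by apply: le_trans (ler1_powR _ q1) _; rewrite ?powRr1 ?ler1n.
by rewrite /w; case: (leP `|u| `|v|) => _; rewrite ?lerDl ?lerDr powR_ge0.
Qed.

Lemma inv_s_gt0 i : 0 < ((s i)%:R : R)^-1.
Proof. by rewrite invr_gt0 ltr0n. Qed.
Lemma inv_s_le1 i : ((s i)%:R : R)^-1 <= 1.
Proof. by rewrite invf_le1 ?ltr0n // ler1n. Qed.

Lemma powR_dil (lam u : R) i : 0 < lam ->
  `|dil s lam i * u| `^ (s i)%:R^-1 = lam * `|u| `^ (s i)%:R^-1.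
Proof.
move=> l0; rewrite normrM (gtr0_norm (dil_gt0 s i l0)) powRM ?(ltW (dil_gt0 s i l0)) //.
congr (_ * _); rewrite /dil -powR_mulrn ?(ltW l0) // -powRrM mulfV ?powRr1 ?(ltW l0) //.
by rewrite pnatr_eq0 -lt0n.
Qed.

Lemma adist_ge0 x y : 0 <= adist s x y.
Proof. by apply: sumr_ge0 => i _; exact: powR_ge0. Qed.

Lemma adist_affm x (lam : R) y : 0 < lam ->
  adist s 0 (affm x (dil s lam) y) <= 2 * (adist s 0 x + lam * adist s 0 y).
Proof.
move=> l0; rewrite /adist mulr_sumr -big_split /= mulr_sumr; apply: ler_sum => i _.
rewrite !mxE !sub0r !normrN -(powR_dil _ _ l0).
exact: powR_quasi_add (inv_s_gt0 i) (inv_s_le1 i).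
Qed.

Lemma adist_le_norm y : adist s 0 y <= d%:R * (1 + `|y|).
Proof.
rewrite /adist (@le_trans _ _ (\sum_(i < d) (1 + `|y|))) //; last first.
  by rewrite sumr_const card_ord mulr_natl.
apply: ler_sum => i _; rewrite mxE sub0r normrN.
apply: (@le_trans _ _ ((1 + `|y|) `^ (s i)%:R^-1)).
  apply: ge0_ler_powR; rewrite ?nnegrE ?addr_ge0 ?(ltW (inv_s_gt0 i)) //.
  by apply: le_trans (normrV_ge y i) _; rewrite lerDr.
apply: le_trans (ler1_powR _ (inv_s_le1 i)) _; first by rewrite lerDl.
exact: lexx.
Qed.

(** Covers both limits at once: [lam] to infinity when p < 0, where only lam >= 1 is available, and
    [lam] to 0 when p > 0. *)
Lemma powR_decay_le0 (q c p : R) : 0 <= c -> p != 0 ->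
  (forall lam : R, 0 < lam -> (p < 0 -> 1 <= lam) -> q <= c * lam `^ p) -> q <= 0.
Proof.
move=> c0 p0 H; rewrite leNgt; apply/negP => q0.
(* Taking lam = t^(1/p) gives lam^p = t, and c t < q. Since t <= 1, this [lam] is at least 1 when p
   is negative. *)
pose t := q / (2 * (c + q)).
have cq : 0 < c + q by rewrite ltr_wpDl.
have t0 : 0 < t by rewrite divr_gt0 // mulr_gt0.
have t1 : t <= 1 by rewrite ler_pdivrMr ?mulr_gt0 //; lra.
have := H (t `^ p^-1) (powR_gt0 _ t0).
rewrite -powRrM mulVf // powRr1 ?(ltW t0) // => K.
have : q <= c * t.
  apply: K => pn; rewrite -[p^-1]opprK powRN invf_ge1 ?powR_gt0 //.
  apply: (@le_trans _ _ (1 `^ (- p^-1))); last by rewrite powR1.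
  apply: ge0_ler_powR; rewrite ?nnegrE ?(ltW t0) //.
  by rewrite oppr_ge0 invr_le0 ltW.
rewrite mulrA ler_pdivlMr ?mulr_gt0 //; nra.
Qed.

(** The point is reached from the origin by switching on one coordinate at a time, so only partial
    derivatives enter. *)
Lemma zero_gradient_const g : (forall i x, derivable g x (evec R i)) ->
  (forall i x, pd i g x = 0) -> forall x, g x = g 0.
Proof.
move=> dg g0 x; pose z (k : nat) : pt := \row_i (if (i < k)%N then x 0 i else 0).
have zd : z d = x by apply/rowP => i; rewrite mxE ltn_ord.
have z0 : z 0%N = 0 by apply/rowP => i; rewrite !mxE.
suff E k : (k <= d)%N -> g (z k) = g 0 by rewrite -{1}zd E.
elim: k => [|k IH] kd; first by rewrite z0.
rewrite -(IH (ltnW kd)); pose j := Ordinal kd.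
pose h (t : R) := g (t *: evec R j + z k).
have dh t : is_derive t (1 : R) h 0.
  have E : (fun v : R => v^-1 *: (h (v *: 1 + t) - h t)) =
      (fun v : R => v^-1 *: (g (v *: evec R j + (t *: evec R j + z k)) - g (t *: evec R j + z k))).
    by apply/funext => v; rewrite /h [v *: 1]mulr1 scalerDl addrA.
  apply: DeriveDef; first by rewrite /derivable E; exact: dg.
  by rewrite /derive E; exact: g0.
have := @is_derive_0_is_cst _ h (x 0 j) 0 dh.
rewrite /h scale0r add0r => <-; congr g; apply/rowP => i; rewrite !mxE ltnS -val_eqE /=.
case: (ltngtP i k) => ik; rewrite ?mulr0 ?add0r //.
by rewrite mulr1 addr0; congr (x _ _); apply/val_inj.
Qed.

Lemma liouville (eta K : R) V : 0 < eta -> (forall n : nat, eta <> n%:R) ->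
  sol s a V -> (forall y, cabs (V y) <= K * adist s 0 y `^ eta) -> V = fun=> 0.
Proof.
move=> e0 en; suff H W : sol s a W -> (forall y, cabs (W y) <= K * adist s 0 y `^ eta) ->
    forall y, Re (W y) = 0.
  move=> sV hV; apply/funext => y; apply: complex_ext; first exact: H.
  (* The imaginary part of V is the real part of -iV, which is a solution of the same growth. *)
  have sW : sol s a (fun y => (- 'i%C) * V y + 0) by apply: sol_lin => //; exact: sol0.
  transitivity (Re ((- 'i%C) * V y + 0)).
    by rewrite addr0 ReM /=; case: (V y) => u v /=; ring.
  by apply: (H _ sW) => z; rewrite addr0 cabsM cabsN /cabs /= expr0n expr1n add0r sqrtr1 mul1r; exact: hV.
move=> sW hW.
pose N := Num.bound eta.
have eN : eta <= N%:R by apply: ltW; apply: archi_boundP; exact: ltW.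
have K0 : 0 <= `|K| by [].
have sR : smoothR setT (fun y => Re (W y)) by have [] := sol_smooth hL sW.
have growth x (lam : R) : 0 < lam ->
    wbound N (fun y => W (affm x (dil s lam) y)) (`|K| * (2 * adist s 0 x + 2 * d%:R * lam) `^ eta).
  move=> l0 y; apply: le_trans (hW _) _.
  set D := 2 * adist s 0 x + 2 * d%:R * lam.
  have D0 : 0 <= D by rewrite addr_ge0 ?mulr_ge0 ?adist_ge0 // ltW.
  have y1 : 1 <= 1 + `|y| by rewrite lerDl.
  have h : adist s 0 (affm x (dil s lam) y) <= D * (1 + `|y|).
    apply: le_trans (adist_affm _ _ l0) _.
    have h1 := ler_wpM2l (ltW l0) (adist_le_norm y).
    have h2 : adist s 0 x <= adist s 0 x * (1 + `|y|) by rewrite ler_peMr // adist_ge0.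
    rewrite /D; nra.
  clearbody D.
  rewrite -mulrA; apply: (@le_trans _ _ (`|K| * adist s 0 (affm x (dil s lam) y) `^ eta)).
    by rewrite ler_wpM2r ?powR_ge0 // ler_norm.
  rewrite ler_wpM2l //.
  apply: (@le_trans _ _ ((D * (1 + `|y|)) `^ eta)).
    by apply: ge0_ler_powR; rewrite ?nnegrE ?(ltW e0) ?adist_ge0 ?(mulr_ge0 D0 (le_trans ler01 y1)).
  rewrite powRM ?addr_ge0 // ler_wpM2l ?powR_ge0 // /weight -powR_mulrn ?addr_ge0 //.
  exact: ler_powR.
have far l x : eta < (wt l)%:R -> pdl l (fun y => Re (W y)) x = 0.
  move=> lw; apply/eqP; rewrite -normr_le0.
  have [B B0 hB] := sol_derive_scaled N l.
  pose c := 2 * adist s 0 x + 2 * d%:R.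
  have c0 : 0 <= c by rewrite addr_ge0 ?mulr_ge0 ?adist_ge0.
  apply: (@powR_decay_le0 _ (B * (`|K| * c `^ eta)) (eta - (wt l)%:R)).
  - by rewrite !mulr_ge0 ?powR_ge0.
  - by rewrite subr_eq0; apply/eqP; exact: en.
  - move=> lam l0 /(_ _) h1; have l1 : 1 <= lam by apply: h1; rewrite subr_lt0.
    have := hB _ _ x lam l0 sW (growth x lam l0).
    rewrite -powR_mulrn ?(ltW l0) // mulrC -ler_pdivlMr ?powR_gt0 // => h2.
    apply: le_trans h2 _; rewrite powRB ?(gt_eqF l0) ?implybT // mulrA ler_pM2r ?invr_gt0 ?powR_gt0 //.
    rewrite -!mulrA; apply: ler_wpM2l => //; apply: ler_wpM2l => //.
    rewrite -powRM ?(ltW l0) //; apply: ge0_ler_powR; rewrite ?nnegrE ?(ltW e0) //.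
    + by rewrite addr_ge0 ?mulr_ge0 ?adist_ge0 // ltW.
    + by rewrite mulr_ge0 // ltW.
    + have h3 : 0 <= adist s 0 x * (lam - 1) by rewrite mulr_ge0 ?adist_ge0 ?subr_ge0.
      rewrite /c; lra.
(* Only at the origin is the growth bound a pure multiple of lam^eta, which is what makes small
   [lam] useful. *)
have near0 l : (wt l)%:R < eta -> pdl l (fun y => Re (W y)) 0 = 0.
  move=> lw; apply/eqP; rewrite -normr_le0.
  have [B B0 hB] := sol_derive_scaled N l.
  apply: (@powR_decay_le0 _ (B * (`|K| * (2 * d%:R) `^ eta)) (eta - (wt l)%:R)).
  - by rewrite !mulr_ge0 ?powR_ge0.
  - by rewrite subr_eq0; apply/eqP; exact: en.
  - move=> lam l0 _.
    have := hB _ _ 0 lam l0 sW (growth 0 lam l0).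
    rewrite -powR_mulrn ?(ltW l0) // mulrC -ler_pdivlMr ?powR_gt0 // => h2.
    apply: le_trans h2 _; rewrite powRB ?(gt_eqF l0) ?implybT // mulrA ler_pM2r ?invr_gt0 ?powR_gt0 //.
    rewrite -!mulrA; apply: ler_wpM2l => //; apply: ler_wpM2l => //.
    have -> : adist s (0 : pt) 0 = 0.
      by rewrite /adist big1 // => i _; rewrite mxE subrr normr0 powR0 // invr_eq0 pnatr_eq0 -lt0n.
    by rewrite mulr0 add0r mulrA powRM ?mulr_ge0 // ltW.
have sz l : (size l <= wt l)%N.
  elim: l => [//|i l IH]; rewrite /wt big_cons /= -add1n; apply: leq_add => //; exact: hs.
(* Descending induction on the length of [l]. At length N or more the weight exceeds eta. Below
   that, all further derivatives vanish, so this one is constant: it vanishes by [far], or its value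
   at 0 does by [near0], since its weight is not eta. *)
suff Z k l : (N <= k + size l)%N -> forall x, pdl l (fun y => Re (W y)) x = 0.
  by move=> y; apply: (Z N [::]); rewrite addn0.
elim: k l => [|k IH] l.
  rewrite add0n => Nl x; apply: far; have := en (wt l).
  have : eta <= (wt l)%:R by apply: le_trans eN _; rewrite ler_nat (leq_trans Nl).
  by rewrite le_eqVlt => /predU1P[].
rewrite addSnnS => Nl x.
have g0 : forall i z, pd i (pdl l (fun y => Re (W y))) z = 0 by move=> i z; exact: (IH (i :: l)).
have [lt|ge] := ltP eta (wt l)%:R; first exact: far.
rewrite (zero_gradient_const _ g0).
  apply: near0; rewrite lt_neqAle ge andbT; apply/eqP => E; exact: (en (wt l)).
by move=> i z; apply: smoothR_derivable; exact: smoothR_pdl.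
Qed.

End Liouville.

(** * Equicontinuity and compactness *)

Section PolyModulus.
Context {R : realType}.
Notation C := R[i].

Lemma poly_increment (q : {poly C}) : exists2 K : R, 0 <= K &
  forall t : R, `|t| <= 1 -> cabs (q.[t%:C] - q.[0]) <= K * `|t|.
Proof.
exists (\sum_(i < size q) cabs q`_i); first by apply: sumr_ge0 => i _; exact: cabs_ge0.
move=> t t1; rewrite !horner_coef -sumrB mulr_suml.
apply: cabs_sum => i; rewrite -mulrBr cabsM ler_wpM2l ?cabs_ge0 //.
case: (i : nat) => [|k]; first by rewrite !expr0 subrr cabs0.
have -> : (t%:C ^+ k.+1 - 0 ^+ k.+1 : C) = (t ^+ k.+1)%:C by rewrite expr0n /= subr0 rmorphXn.
rewrite cabsR normrX exprS ler_piMr //.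
exact: exprn_ile1.
Qed.

(** Lagrange interpolation at the nodes 1/(j+1) writes [p] in a fixed finite family of polynomials
    with coefficients p(x_j), all bounded by [M]; only the fixed family determines [K]. *)
Lemma poly_modulus (k : nat) : exists2 K : R, 0 <= K &
  forall (p : {poly C}) (M : R), (size p <= k.+1)%N ->
    (forall t : R, `|t| <= 1 -> cabs p.[t%:C] <= M) ->
    forall t : R, `|t| <= 1 -> cabs (p.[t%:C] - p.[0]) <= K * M * `|t|.
Proof.
pose x (j : nat) : C := (j.+1%:R^-1)%:C.
have x_inj : injective x.
  move=> i j /complexI/invr_inj/eqP; rewrite eqr_nat => /eqP[]; exact.
pose L (i : 'I_k.+1) : {poly C} := tnth (lagrange k.+1 x) i.
have /choice[K hK] : forall i, exists K : R, 0 <= K /\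
    forall t : R, `|t| <= 1 -> cabs ((L i).[t%:C] - (L i).[0]) <= K * `|t|.
  by move=> i; have [K K0 h] := poly_increment (L i); exists K.
exists (\sum_i K i); first by apply: sumr_ge0 => i _; have [] := hK i.
move=> p M sp pM t t1.
have M0 : 0 <= M by apply: le_trans (pM 0 _); rewrite ?cabs_ge0 // normr0.
rewrite (lagrange_gen (ltn0Sn k) x_inj sp) !horner_sum -sumrB -mulrA mulr_suml.
apply: cabs_sum => i; rewrite !hornerM !hornerC -mulrBr cabsM mulrCA.
have [_ h] := hK i; apply: ler_pM; rewrite ?cabs_ge0 //; last exact: h.
by apply: pM; rewrite ger0_norm ?invr_ge0 // invf_le1 ?ltr0n // ler1n.
Qed.

End PolyModulus.

(** * Equicontinuity and limits of blow-up sequences *)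

Section Compactness.
Context {R : realType} {d : nat}.
Variables (s : 'I_d -> nat) (m : nat) (a : {ffun 'I_d -> 'I_m.+1} -> R[i]).
Hypothesis (hs : forall i, (0 < s i)%N) (hL : elliptic s a).
Notation pt := 'rV[R]_d.
Notation C := R[i].
Notation Re := complex.Re.
Notation Im := complex.Im.
Implicit Types (V W phi psi : pt -> C) (f g : pt -> R) (p x y : pt) (l : seq 'I_d).

Lemma adist_line w (i : 'I_d) (t : R) : adist s w (w + t *: evec R i) = `|t| `^ (s i)%:R^-1.
Proof.
rewrite /adist (bigD1 i) //= big1 ?addr0.
  by rewrite !mxE eqxx mulr1 opprD addrA subrr sub0r normrN.
move=> j ji; rewrite !mxE eq_sym (negbTE ji) mulr0 addr0 subrr normr0 powR0 //.
by rewrite invr_eq0 pnatr_eq0 -lt0n.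
Qed.

Lemma small_line_powR (alpha e : R) : 0 < alpha -> 0 < e ->
  exists delta : R, [/\ 0 < delta, delta <= 1 &
    forall (i : 'I_d) (t : R), `|t| <= delta -> (`|t| `^ (s i)%:R^-1) `^ alpha <= e].
Proof.
move=> a0 e0; pose e' := Num.min 1 (e `^ alpha^-1).
have e'0 : 0 < e' by rewrite lt_min ltr01 powR_gt0.
have e'1 : e' <= 1 by rewrite ge_min lexx.
have e'e : e' <= e `^ alpha^-1 by rewrite ge_min lexx orbT.
(* Since e' <= 1, this is at most e'^(s i) for every i, so one radius serves all directions. *)
exists (e' ^+ (\sum_i s i)); split; first exact: exprn_gt0.
  by apply: exprn_ile1 => //; exact: ltW.
move=> i t ht; have ti : `|t| <= e' ^+ s i.
  apply: le_trans ht _; apply: ler_wiXn2l; rewrite ?(ltW e'0) //.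
  by rewrite (bigD1 i) //= leq_addr.
have i0 : 0 < (s i)%:R :> R by rewrite ltr0n.
have h1 : `|t| `^ (s i)%:R^-1 <= e'.
  apply: (@le_trans _ _ ((e' ^+ s i) `^ (s i)%:R^-1)).
    by apply: ge0_ler_powR; rewrite ?nnegrE ?invr_ge0 ?(ltW i0) ?exprn_ge0 ?(ltW e'0).
  by rewrite -powR_mulrn ?(ltW e'0) // -powRrM mulfV ?lt0r_neq0 // powRr1 ?(ltW e'0).
apply: (@le_trans _ _ ((e `^ alpha^-1) `^ alpha)).
  by apply: ge0_ler_powR; rewrite ?nnegrE ?powR_ge0 ?(ltW a0) //; exact: le_trans h1 e'e.
by rewrite -powRrM mulVf ?lt0r_neq0 // powRr1 ?(ltW e0).
Qed.

(** Only the restrictions to coordinate lines are retained: they survive dilations and are all that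
    one-variable interpolation needs. *)
Definition line_poly (k : nat) (P : pt -> C) :=
  forall w (i : 'I_d), exists2 p : {poly C}, (size p <= k.+1)%N &
    forall t : R, P (w + t *: evec R i) = p.[t%:C].

(** What a normalized blow-up keeps of its germ. In the last error, the first term bounds the
    rescaled U_y and the second is the three-point seminorm between the base point and y. *)
Definition approx_germ (k : nat) (eta alpha : R) V :=
  [/\ contC V, (forall y, cabs (V y) <= 2 * adist s 0 y `^ eta) &
    forall y, exists2 P, line_poly k P & forall z, cabs (V z - P z) <=
      2 * adist s y z `^ eta + adist s y z `^ alpha * (adist s 0 y + adist s y z) `^ (eta - alpha)].

Lemma line_equicontinuous k (eta alpha r e : R) : 0 < alpha -> alpha < eta -> 0 <= r -> 0 < e ->
  exists2 delta : R, 0 < delta & forall V w (i : 'I_d) (t : R), approx_germ k eta alpha V ->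
    `|w| <= r -> `|t| <= delta -> cabs (V (w + t *: evec R i) - V w) <= e.
Proof.
move=> a0 ae r0 e0; have eta0 : 0 < eta by exact: lt_trans ae.
(* [A] bounds d(0, .) up to distance 1 from the ball of radius r, [M1] bounds V there, and [c]
   gathers both error terms, as eta > alpha and the distances along the line are at most 1. *)
pose A : R := d%:R * (2 + r).
have A0 : 0 <= A by rewrite mulr_ge0 // addr_ge0.
pose M1 := 2 * A `^ eta; pose c := 2 + (A + 1) `^ (eta - alpha).
have M10 : 0 <= M1 by rewrite mulr_ge0 ?powR_ge0.
have c0 : 0 < c by rewrite ltr_wpDr ?powR_ge0.
have [K K0 hK] := @poly_modulus R k.
have [|d1 [d10 d11 hd1]] := @small_line_powR alpha (e / (2 * c)) a0.
  by rewrite divr_gt0 // mulr_gt0.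
pose d2 := e / (2 * (K * (M1 + c) + 1)).
have Q0 : 0 <= K * (M1 + c) by rewrite mulr_ge0 // addr_ge0 // ltW.
have d20 : 0 < d2 by rewrite divr_gt0 // mulr_gt0 // ltr_wpDl.
exists (Num.min d1 d2); first by rewrite lt_min d10.
move=> V w i t [_ V1 V2] wr; rewrite le_min => /andP[td1 td2].
have t1 : `|t| <= 1 by exact: le_trans td1 d11.
have [P lP hP] := V2 w; have [p sp pE] := lP w i.
have Dw : adist s 0 w <= A.
  apply: le_trans (adist_le_norm hs _) _; rewrite /A ler_wpM2l //; lra.
have err u : `|u| <= 1 -> cabs (V (w + u *: evec R i) - p.[u%:C]) <= c * (`|u| `^ (s i)%:R^-1) `^ alpha.
  move=> u1; have := hP (w + u *: evec R i); rewrite pE adist_line.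
  set tau := `|u| `^ _; have tau0 : 0 <= tau by exact: powR_ge0.
  have tau1 : tau <= 1.
    apply: (@le_trans _ _ (1 `^ (s i)%:R^-1)); last by rewrite powR1.
    by apply: ge0_ler_powR; rewrite ?nnegrE // invr_ge0.
  move=> /le_trans; apply; rewrite /c [X in _ <= X]mulrDl; apply: lerD.
    rewrite ler_wpM2l //.
    have [->|tn0] := eqVneq tau 0; first by rewrite !powR0 ?lt0r_neq0.
    by apply: ger_powR; [rewrite lt0r tn0 tau0 tau1|exact: ltW].
  rewrite mulrC ler_wpM2r ?powR_ge0 //; apply: ge0_ler_powR; rewrite ?nnegrE ?(addr_ge0 A0) ?(addr_ge0 (adist_ge0 s 0 w) tau0) ?subr_ge0 ?(ltW ae) //.
  exact: lerD.
have powle u : `|u| <= 1 -> (`|u| `^ (s i)%:R^-1) `^ alpha <= 1.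
  move=> u1; apply: (@le_trans _ _ (1 `^ alpha)); last by rewrite powR1.
  apply: ge0_ler_powR; rewrite ?nnegrE ?powR_ge0 ?(ltW a0) //.
  apply: (@le_trans _ _ (1 `^ (s i)%:R^-1)); last by rewrite powR1.
  by apply: ge0_ler_powR; rewrite ?nnegrE // invr_ge0.
have e_norm u : `|u *: evec R i| <= `|u|.
  by apply: normrV_le => // j; rewrite !mxE normrM; case: (_ == _); rewrite /= ?normr1 ?normr0 ?mulr1 ?mulr0.
have pM u : `|u| <= 1 -> cabs p.[u%:C] <= M1 + c.
  move=> u1.
  have -> : p.[u%:C] = V (w + u *: evec R i) - (V (w + u *: evec R i) - p.[u%:C]) by ring.
  apply: le_trans (cabsD _ _) _; rewrite cabsN; apply: lerD.
    apply: le_trans (V1 _) _; rewrite ler_wpM2l //.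
    apply: ge0_ler_powR; rewrite ?nnegrE ?adist_ge0 ?(ltW eta0) //.
    apply: le_trans (adist_le_norm hs _) _; rewrite /A ler_wpM2l //.
    have := ler_normD w (u *: evec R i); have := e_norm u; lra.
  by apply: le_trans (err u u1) _; rewrite ger_pMr // powle.
(* The error vanishes at its own base point, so the polynomial interpolates V there. *)
have V0 : V w = p.[0].
  have := err 0; rewrite normr0 ler01 scale0r addr0 powR0 ?invr_eq0 ?pnatr_eq0 -?lt0n // powR0 ?lt0r_neq0 // mulr0.
  by move=> /(_ isT)/cabs_eq0/eqP; rewrite subr_eq0 => /eqP.
have -> : V (w + t *: evec R i) - V w =
    (V (w + t *: evec R i) - p.[t%:C]) + (p.[t%:C] - p.[0]) by rewrite V0; ring.
apply: le_trans (cabsD _ _) _.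
have h1 : cabs (V (w + t *: evec R i) - p.[t%:C]) <= e / 2.
  apply: le_trans (err t t1) _; have := hd1 i t td1.
  move=> h; apply: le_trans (ler_wpM2l (ltW c0) h) _; rewrite le_eqVlt; apply/orP; left.
  by apply/eqP; field; exact: lt0r_neq0.
have h2 : cabs (p.[t%:C] - p.[0]) <= e / 2.
  apply: le_trans (hK p (M1 + c) sp pM t t1) _.
  have h : `|t| * (2 * (K * (M1 + c) + 1)) <= e by rewrite -ler_pdivlMr // mulr_gt0 // ltr_wpDl.
  have := normr_ge0 t; lra.
lra.
Qed.

(** One coordinate is changed at a time; in the maximum norm the intermediate points stay in the
    same ball. The share e / (d + 1) per step also makes sense when d = 0. *)
Lemma equicontinuous k (eta alpha r e : R) : 0 < alpha -> alpha < eta -> 0 <= r -> 0 < e ->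
  exists2 delta : R, 0 < delta & forall V x y, approx_germ k eta alpha V ->
    `|x| <= r -> `|y| <= r -> `|x - y| <= delta -> cabs (V x - V y) <= e.
Proof.
move=> a0 ae r0 e0; have [|dl dl0 hd] := @line_equicontinuous k eta alpha r (e / d.+1%:R) a0 ae r0.
  by rewrite divr_gt0.
exists dl => // V x y hV xr yr xy.
pose z (n : nat) : pt := \row_i (if (i < n)%N then x 0 i else y 0 i).
have zr n : `|z n| <= r.
  apply: normrV_le => // i; rewrite mxE; case: ifP => _.
    exact: le_trans (normrV_ge x i) xr.
  exact: le_trans (normrV_ge y i) yr.
have zd : z d = x by apply/rowP => i; rewrite mxE ltn_ord.
have z0 : z 0%N = y by apply/rowP => i; rewrite !mxE.
suff E n : (n <= d)%N -> cabs (V (z n) - V y) <= n%:R * (e / d.+1%:R).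
  rewrite -zd; apply: le_trans (E d (leqnn d)) _.
  by rewrite mulrA ler_pdivrMr // mulrC ler_pM2l // ler_nat.
elim: n => [|n IH] nd; first by rewrite z0 subrr cabs0 mul0r.
pose j := Ordinal nd.
have zS : z n.+1 = z n + (x 0 j - y 0 j) *: evec R j.
  apply/rowP => i; rewrite !mxE ltnS -val_eqE /=.
  case: (ltngtP i n) => ik; rewrite ?mulr0 ?addr0 //.
  have -> : i = j by apply/val_inj.
  rewrite /=; ring.
have -> : V (z n.+1) - V y = (V (z n.+1) - V (z n)) + (V (z n) - V y) by ring.
apply: le_trans (cabsD _ _) _; rewrite -natr1 mulrDl mul1r addrC; apply: lerD.
  exact: IH (ltnW nd).
rewrite zS; apply: hd => //; apply: le_trans xy.
by have := normrV_ge (x - y) j; rewrite !mxE.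
Qed.

(** An ultrafilter provides limits at all points simultaneously, in place of a diagonal
    subsequence. *)
Lemma ultra_bounded_limit (F : set_system nat) (u : nat -> R) (B : R) : UltraFilter F ->
  (forall n, `|u n| <= B) -> exists l : R, forall e : R, 0 < e -> \forall n \near F, `|u n - l| <= e.
Proof.
move=> FU uB; have cI : compact `[- B, B]%classic by exact: segment_compact.
have FF : ProperFilter F by exact: ultra_proper.
have uI : F [set n | `[- B, B]%classic (u n)].
  rewrite (_ : [set n | _] = setT); first exact: filterT.
  by apply/seteqP; split => // n _ /=; rewrite in_itv /= -ler_norml.
have [l [_ cl]] := cI (u @ F) _ uI; exists l => e e0.
have [//|FC] := in_ultra_setVsetC [set n | `|u n - l| <= e] FU.
have nl : nbhs l [set t | `|t - l| < e].
  by apply/nbhs_ballP; exists e => //= t; rewrite -ball_normE /= distrC.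
have [t [/= tC tl]] := cl [set t | ~ `|t - l| <= e] _ FC nl.
by case: tC; exact: ltW.
Qed.

Lemma blowup_limit k (eta alpha : R) (V : nat -> pt -> C) : 0 < alpha -> alpha < eta ->
  (forall n : nat, eta <> n%:R) ->
  (forall n, approx_germ k eta alpha (V n)) ->
  (forall psi, testfun setT psi -> exists K : R, forall n,
     cabs (cint (fun y => V n y * LT s a psi y)) <= K * n.+1%:R^-1) ->
  forall e : R, 0 < e -> exists n, forall y, `|y| <= 1 -> cabs (V n y) <= e.
Proof.
move=> a0 ae en hV hT.
have eta0 : 0 < eta by exact: lt_trans ae.
have [F [FU Foo]] := ultraFilterLemma eventually_filter.
have FF : ProperFilter F by exact: ultra_proper.
have FI (A B : set nat) : F A -> F B -> F (A `&` B) by exact: filterI.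
have FE (A : set nat) : F A -> exists n, A n by exact: filter_ex.
have P y : exists z : C, forall e : R, 0 < e -> \forall n \near F, cabs (V n y - z) <= e.
  pose B := 2 * adist s 0 y `^ eta.
  have [|l hl] := @ultra_bounded_limit F (fun n => Re (V n y)) B FU.
    by move=> n; have [_ h _] := hV n; exact: le_trans (cabs_Re _) (h y).
  have [|l' hl'] := @ultra_bounded_limit F (fun n => Im (V n y)) B FU.
    by move=> n; have [_ h _] := hV n; exact: le_trans (cabs_Im _) (h y).
  exists (l +i* l') => e e0; have e20 : 0 < e / 2 by rewrite divr_gt0.
  refine (filterS _ (FI _ _ (hl _ e20) (hl' _ e20))) => n [h1 h2].
  apply: le_trans (cabs_le _) _; rewrite ReD ImD /=; lra.
have [W hW] := choice P.
have Wequi r e : 0 <= r -> 0 < e -> exists2 delta : R, 0 < delta & forall x y,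
    `|x| <= r -> `|y| <= r -> `|x - y| <= delta ->
    (forall n, cabs (V n x - V n y) <= e) /\ cabs (W x - W y) <= e + e.
  move=> r0 e0; have [dl dl0 hd] := equicontinuous k a0 ae r0 e0.
  exists dl => // x y xr yr xy; split; first by move=> n; exact: hd.
  have e20 : 0 < e / 2 by rewrite divr_gt0.
  have /FE[n [h1 h2]] := FI _ _ (hW x _ e20) (hW y _ e20).
  have h3 := hd _ x y (hV n) xr yr xy.
  have -> : W x - W y = (V n x - V n y) + ((V n y - W y) - (V n x - W x)) by ring.
  apply: le_trans (cabsD _ _) _; apply: lerD => //.
  by apply: le_trans (cabsD _ _) _; rewrite cabsN; lra.
(* Near each point x, equicontinuity transfers the convergence at x to its neighbours, at a cost of
   e/4 for V and e/2 for W; compactness makes this uniform. *)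
have unif r e : 0 <= r -> 0 < e -> \forall n \near F, forall y, `|y| <= r -> cabs (V n y - W y) <= e.
  move=> r0 e0.
  have cK := @compact_closed_ball R d (r).
  have e40 : 0 < e / 4 by rewrite divr_gt0.
  have [|dl dl0 hd] := Wequi (r + 1) (e / 4) _ e40; first by rewrite addr_ge0.
  have /compact_near_coveringP/(_ nat F (fun n y => cabs (V n y - W y) <= e) _) := cK.
  apply => x /= xr.
  exists ([set y | `|x - y| < Num.min dl 1], [set n | cabs (V n x - W x) <= e / 4]).
    split => /=; last exact: hW.
    by apply/nbhs_ballP; exists (Num.min dl 1) => /=; [rewrite lt_min dl0 /=|move=> y; rewrite -ball_normE].
  move=> [y n] /= [xy h]; move: xy; rewrite lt_min => /andP[xy1 xy2].
  have yr : `|y| <= r + 1.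
    by have := ler_normB x (x - y); rewrite opprB addrCA subrr addr0; lra.
  have [|h1 h2] := hd x y _ yr (ltW xy1); first by lra.
  have -> : V n y - W y = (V n x - W x) + (W x - W y) - (V n x - V n y) by ring.
  have h3 := cabsD ((V n x - W x) + (W x - W y)) (- (V n x - V n y)).
  have h4 := cabsD (V n x - W x) (W x - W y).
  have h5 := h1 n; rewrite cabsN in h3; lra.
have sW : sol s a W.
  apply: sol_closed => r e psi e0 tpsi.
  have [K hK] := hT psi tpsi.
  have K1 : 0 < `|K| + 1 by rewrite ltr_wpDl.
  have e1 : 0 < e / (`|K| + 1) by rewrite divr_gt0.
  have Fe : \forall n \near F, n.+1%:R^-1 < e / (`|K| + 1).
    by apply: Foo; exact: near_infty_natSinv_lt (PosNum e1).
  have /FE[n [h1 h2]] := FI _ _ Fe (unif `|r| e (normr_ge0 r) e0).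
  exists (V n); split; first by have [] := hV n.
    move=> x xr; have := h2 x (le_trans xr (ler_norm r)).
    by rewrite -cabsN opprB.
  apply: le_trans (hK n) _; apply: (@le_trans _ _ ((`|K| + 1) * n.+1%:R^-1)).
    by rewrite ler_wpM2r ?invr_ge0 //; have := ler_norm K; lra.
  by rewrite mulrC -ler_pdivlMr // ltW.
have W0 : W = fun=> 0.
  apply: (liouville hs hL eta0 en sW (K := 2)) => y; apply/ler_addgt0Pr => e e0.
  have /FE[n h] := hW y e e0; have [_ h2 _] := hV n.
  have -> : W y = V n y - (V n y - W y) by ring.
  by apply: le_trans (cabsD _ _) _; rewrite cabsN; apply: lerD.
move=> e e0; have /FE[n hn] := unif 1 e ler01 e0.
by exists n => y /hn; rewrite W0 subr0.
Qed.

End Compactness.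

(** * Blow-up of germs *)

Section Blowup.
Context {R : realType} {d : nat}.
Variables (s : 'I_d -> nat) (m : nat) (a : {ffun 'I_d -> 'I_m.+1} -> R[i]).
Hypothesis (hs : forall i, (0 < s i)%N).
Notation pt := 'rV[R]_d.
Notation C := R[i].
Notation Re := complex.Re.
Notation Im := complex.Im.
Implicit Types (V W phi psi : pt -> C) (f g : pt -> R) (p x y : pt) (l : seq 'I_d).

Lemma adist_sym x y : adist s x y = adist s y x.
Proof. by apply: eq_bigr => i _; rewrite distrC. Qed.

Lemma adist_dil x (lam : R) y z : 0 < lam ->
  adist s (affm x (dil s lam) y) (affm x (dil s lam) z) = lam * adist s y z.
Proof.
move=> l0; rewrite /adist mulr_sumr; apply: eq_bigr => i _; rewrite -(powR_dil hs _ _ l0) !mxE.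
by congr (`|_| `^ _); ring.
Qed.

Lemma affm0 x (lam : R) : affm x (dil s lam) 0 = x.
Proof. by apply/rowP => i; rewrite !mxE mulr0 addr0. Qed.

Lemma affm01 y : affm (0 : pt) (dil s 1) y = y.
Proof. by apply/rowP => i; rewrite dil1 !mxE mul1r add0r. Qed.

(** Makes the seminorm [L U], which sees only rescaled members of the class, control the pairing
    with an arbitrary test function. *)
Lemma Bclass_span (gam : R) psi : testfun setT psi ->
  exists phi (c mu : R), [/\ Bclass s gam phi, 0 < c, 0 < mu &
    psi = fun y => c%:C * rescale s phi 0 mu y].
Proof.
move=> tpsi; have /testfunP[spsi [M0 hM0]] := tpsi.
(* If mu^s y lies in the support of [psi], then mu d(y, 0) <= d (1 + M) < mu, where the last d is
   the dimension; so [phi] lives in the unit ball. *)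
pose M := `|M0|; pose mu : R := d%:R * (1 + M) + 1.
have M_ge0 : 0 <= M by exact: normr_ge0.
have mu0 : 0 < mu by rewrite ltr_wpDl // mulr_ge0 // addr_ge0.
pose K := `|Num.ceil `|gam| |%N.
have /choice[B hB] : forall b : {ffun 'I_d -> 'I_K.+1}, exists B : R, 0 < B /\
    forall y, cabs (dmulti (fun i => b i : nat) psi y) <= B.
  move=> b; rewrite dmultiE; have [B B0 h] := CcC_bounded (pdlC_CcC (blist (fun i => b i : nat)) tpsi).
  by exists B.
(* Dominates every derivative of the dilated [psi] up to the required order. Finitely many
   multi-indices suffice: as s_i >= 1, all their entries are at most [K]. *)
pose t : R := 1 + \sum_b mu ^+ sdeg s (fun i => (b : {ffun 'I_d -> 'I_K.+1}) i : nat) * B b.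
have tb b : 0 <= mu ^+ sdeg s (fun i => (b : {ffun 'I_d -> 'I_K.+1}) i : nat) * B b.
  by rewrite mulr_ge0 ?exprn_ge0 ?(ltW mu0) // ltW //; have [] := hB b.
have t0 : 0 < t by rewrite ltr_wpDr // sumr_ge0.
pose phi : pt -> C := fun y => (t^-1)%:C * psi (affm 0 (dil s mu) y).
have tphi : testfun setT phi by apply: testfun_affm => // i; exact: dil_gt0.
exists phi, (mu ^+ (\sum_i s i) * t), mu; split => //.
- split => //.
    move=> y hy; have le : `|affm 0 (dil s mu) y| <= M.
      rewrite leNgt; apply/negP => lt; apply: hy; rewrite /phi hM0 ?mulr0 //.
      by apply: le_lt_trans lt; exact: ler_norm.
    have := adist_le_norm hs (affm 0 (dil s mu) y).
    have := adist_dil 0 0 y mu0; rewrite affm0 => ->.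
    rewrite adist_sym => h.
    rewrite -(ltr_pM2l mu0) mulr1; apply: le_lt_trans h _.
    rewrite /mu ltr_pwDr //; rewrite ler_wpM2l // lerD2l //.
  move=> b bK y.
  have bK' : (sdeg s b <= K)%N.
    have c0 : 0 <= Num.ceil `|gam| by rewrite ceil_ge0 // (lt_le_trans _ (normr_ge0 gam)).
    move: bK; rewrite intz -[in X in _ <= X](gez0_abs c0) lez_nat; exact.
  have bi i : (b i < K.+1)%N.
    rewrite ltnS; apply: leq_trans bK'; rewrite /sdeg (bigD1 i) //=.
    by apply: leq_trans (leq_addr _ _); rewrite leq_pmull.
  pose b' := [ffun i => Ordinal (bi i)].
  have bE : b = (fun i => b' i : nat) by apply/funext => i; rewrite ffunE.
  rewrite dmulti_dil // cabsM cabsR normrM gtr0_norm ?invr_gt0 // gtr0_norm ?exprn_gt0 //.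
  rewrite -mulrA ler_pdivrMl // mulr1; apply: (@le_trans _ _ (mu ^+ sdeg s b * B b')).
    by rewrite ler_wpM2l ?exprn_ge0 ?(ltW mu0) // {1}bE; have [_] := hB b'; exact.
  by rewrite {1}bE /t (bigD1 b') //= addrCA lerDl addr_ge0 // sumr_ge0.
- by rewrite mulr_gt0 // exprn_gt0.
- apply/funext => y; rewrite rescaleE /phi mulrA mulrA -!rmorphM /=.
  rewrite (_ : _ * _ * _ = 1); last first.
    have mun : mu ^+ (\sum_i s i) != 0 by rewrite expf_neq0 // lt0r_neq0.
    by field; rewrite mun lt0r_neq0.
  rewrite mul1r; congr psi; apply/rowP => i; rewrite !mxE /dil exprVn.
  by field; rewrite expf_neq0 // lt0r_neq0.
Qed.

Lemma rescale_rescale phi x (lam mu : R) : 0 < lam -> 0 < mu ->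
  rescale s (rescale s phi 0 mu) x lam = rescale s phi x (lam * mu).
Proof.
move=> l0 m0; apply/funext => y; rewrite /rescale mulrA -rmorphM /= exprMn invfM.
congr (_ * phi _); apply/rowP => i; rewrite !mxE subr0 exprMn invfM; ring.
Qed.

(** The dilation sends coordinate lines to coordinate lines, on which a monomial is a constant times
    a power, at most k, of an affine function. *)
Lemma isPoly_line k P (x : pt) (lam : R) (c : R) : isPoly s k P ->
  line_poly k (fun z => c%:C * P (affm x (dil s lam) z)).
Proof.
move=> [cf hP] w i.
pose g j := x 0 j + dil s lam j * w 0 j.
pose q (b : {ffun 'I_d -> 'I_k.+1}) : {poly C} :=
  (c%:C * cf b * \prod_(j < d | j != i) (g j ^+ b j)%:C)%:P *
  ((g i)%:C%:P + (dil s lam i)%:C *: 'X) ^+ (b i).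
exists (\sum_(b : {ffun 'I_d -> 'I_k.+1} | (sdeg s (fun i => b i : nat) <= k)%N) q b).
  apply: (leq_trans (size_sum _ _ _)); apply/bigmax_leqP => b _.
  have h2 : (size ((g i)%:C%:P + (dil s lam i)%:C *: 'X : {poly C})%R <= 2)%N.
    apply: leq_trans (size_polyD _ _) _; rewrite geq_max; apply/andP; split.
      exact: leq_trans (size_polyC_leq1 _) _.
    by apply: leq_trans (size_scale_leq _ _) _; rewrite size_polyX.
  rewrite /q mul_polyC; apply: leq_trans (size_scale_leq _ _) _.
  apply: leq_trans (size_exp_leq _ _) _; rewrite ltnS.
  apply: (@leq_trans (1 * b i)); first by rewrite leq_mul2r -subn1 leq_subLR h2 orbT.
  by rewrite mul1n -ltnS ltn_ord.
move=> t; rewrite hP horner_sum mulr_sumr; apply: eq_bigr => b _.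
rewrite /q hornerM hornerC horner_exp hornerD hornerC hornerZ hornerX (bigD1 i) //=.
have E1 : affm x (dil s lam) (w + t *: evec R i) 0 i = g i + dil s lam i * t.
  by rewrite !mxE eqxx /g /=; ring.
have E2 j : j != i -> affm x (dil s lam) (w + t *: evec R i) 0 j = g j.
  by rewrite eq_sym !mxE /g => /negbTE ->; rewrite /=; ring.
rewrite E1 (eq_bigr (fun j => (g j ^+ b j)%:C)); last by move=> j ji; rewrite E2.
by rewrite rmorphXn rmorphD rmorphM /=; ring.
Qed.

Lemma blowup_approx_germ k (eta alpha Nn e : R) (U : pt -> pt -> C) x (lam : R) :
  germ U -> 0 < lam -> 0 < Nn -> 0 <= e -> e <= Nn ->
  (forall x y, cabs (U x y) <= 2 * Nn * adist s x y `^ eta) ->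
  (forall x y, exists P, isPoly s k P /\ forall z, cabs (U x z - U y z - P z) <=
     e * adist s y z `^ alpha * (adist s x y + adist s y z) `^ (eta - alpha)) ->
  approx_germ s k eta alpha (fun z => (lam `^ (- eta) / Nn)%:C * U x (affm x (dil s lam) z)).
Proof.
move=> gU l0 N0 e0 eN h1 h2.
have c0 : 0 <= lam `^ (- eta) / Nn by rewrite divr_ge0 ?powR_ge0 // ltW.
have lN : lam `^ (- eta) * lam `^ eta = 1.
  by rewrite -powRD ?addNr ?powRr0 // (gt_eqF l0) implybT.
have scale (X : R) : lam `^ (- eta) / Nn * (2 * Nn * (lam `^ eta * X)) = 2 * X.
  transitivity ((lam `^ (- eta) * lam `^ eta) * (2 * X)); last by rewrite lN mul1r.
  by field; exact: lt0r_neq0.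
split.
- have /(contC_affm x (dil s lam)) cU : contC (U x) by exact: gU.
  have := contC_lin (lam `^ (- eta) / Nn)%:C cU (CcC_cont CcC0).
  by congr contC; apply/funext => z; rewrite addr0.
- move=> y; rewrite cabsM cabsR ger0_norm //.
  have := h1 x (affm x (dil s lam) y); have := adist_dil x 0 y l0; rewrite affm0 => ->.
  rewrite powRM ?(ltW l0) ?adist_ge0 // => h.
  by apply: le_trans (ler_wpM2l c0 h) _; rewrite scale.
- move=> y; have [P [iP hP]] := h2 x (affm x (dil s lam) y).
  exists (fun z => (lam `^ (- eta) / Nn)%:C * P (affm x (dil s lam) z)); first exact: isPoly_line.
  move=> z; rewrite -mulrBr cabsM cabsR ger0_norm //.
  set Az := affm x (dil s lam) z; set Ay := affm x (dil s lam) y.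
  have dyz : adist s Ay Az = lam * adist s y z by exact: adist_dil.
  have dxy : adist s x Ay = lam * adist s 0 y by have := adist_dil x 0 y l0; rewrite affm0.
  (* The germ norm at base point [Ay] bounds the first summand and the three-point condition the
     second. *)
  have -> : U x Az - P Az = U Ay Az + (U x Az - U Ay Az - P Az) by ring.
  apply: le_trans (ler_wpM2l c0 (le_trans (cabsD _ _) (lerD (h1 Ay Az) (hP Az)))) _.
  rewrite -/Ay dyz dxy -mulrDr !powRM ?(ltW l0) ?addr_ge0 ?adist_ge0 //.
  rewrite mulrDr; apply: lerD; first by rewrite scale.
  have lae : lam `^ alpha * lam `^ (eta - alpha) = lam `^ eta.
    by rewrite -powRD ?(gt_eqF l0) ?implybT // addrC subrK.
  set X := adist s y z `^ alpha; set Y := (adist s 0 y + adist s y z) `^ (eta - alpha).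
  have -> : lam `^ (- eta) / Nn * (e * (lam `^ alpha * X) * (lam `^ (eta - alpha) * Y)) =
     (e / Nn) * ((lam `^ (- eta) * (lam `^ alpha * lam `^ (eta - alpha))) * (X * Y)) by ring.
  rewrite lae lN mul1r ler_piMl ?mulr_ge0 ?powR_ge0 //.
  by rewrite ler_pdivrMr // mul1r.
Qed.

(** The powers lam^(-eta), lam^m from the dilation of L, and lam^(eta - m) from the seminorm cancel,
    so [K] depends only on [psi] through its representation in the class. *)
Lemma blowup_LT (eta : R) psi : testfun setT psi ->
  exists K : R, forall (U : pt -> pt -> C) x (lam Nn e : R),
    germ U -> 0 < lam -> 0 < Nn ->
    (forall phi lam, Bclass s (eta - m%:R) phi -> 0 < lam ->
      lam `^ (- (eta - m%:R)) * cabs (cint (fun y => U x y * LT s a (rescale s phi x lam) y)) <= Nn * e) ->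
    cabs (cint (fun y => (lam `^ (- eta) / Nn)%:C * U x (affm x (dil s lam) y) * LT s a psi y)) <= K * e.
Proof.
move=> tpsi; have [phi [c [mu [Bphi c0 mu0 psiE]]]] := Bclass_span (eta - m%:R) tpsi.
have tphi : testfun setT phi by case: Bphi.
exists (c * mu `^ (eta - m%:R)) => U x lam Nn e gU l0 N0 H.
have tr := rescale_testfun s 0 mu0 tphi.
have LE : LT s a psi = fun y => c%:C * LT s a (rescale s phi 0 mu) y.
  have := LT_dil s a c 0 1 (proj1 tr).
  rewrite (_ : (fun y => c%:C * rescale s phi 0 mu (affm 0 (dil s 1) y)) = psi); last first.
    by rewrite psiE; apply/funext => y; rewrite affm01.
  by move=> ->; apply/funext => y; rewrite affm01 expr1n mulr1.
set c1 := lam `^ (- eta) / Nn.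
have c10 : 0 < c1 by rewrite divr_gt0 ?powR_gt0.
have cU : contC (U x) by exact: gU.
have -> : cint (fun y => c1%:C * U x (affm x (dil s lam) y) * LT s a psi y) =
    (c1 * c)%:C * cint (fun y => U x (affm x (dil s lam) y) * LT s a (rescale s phi 0 mu) y).
  rewrite -cintZ; last by apply: CcC_mul; [exact: contC_affm|exact: LT_CcC].
  congr cint; apply/funext => y; rewrite LE.
  by rewrite (_ : (c1 * c)%:C = c1%:C * c%:C); [ring|exact: rmorphM].
rewrite cint_blowup // rescale_rescale // !cabsM !cabsR.
have lm0 : 0 < lam * mu by rewrite mulr_gt0.
have := H phi (lam * mu) Bphi lm0.
set X := cabs _; rewrite mulrC powRN ler_pdivrMr ?powR_gt0 // => h.
have c1c : 0 < c1 * c by exact: mulr_gt0.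
rewrite (gtr0_norm c1c) (gtr0_norm (exprn_gt0 m l0)).
have c2 : 0 <= c1 * c * lam ^+ m := mulr_ge0 (ltW c1c) (exprn_ge0 m (ltW l0)).
rewrite mulrA; apply: le_trans (ler_wpM2l c2 h) _.
rewrite powRM ?(ltW l0) ?(ltW mu0) //.
have E : lam `^ (- eta) * (lam ^+ m * lam `^ (eta - m%:R)) = 1.
  rewrite -powR_mulrn ?(ltW l0) // -!powRD ?(gt_eqF l0) ?implybT //.
  by rewrite addrCA addKr subrr powRr0.
rewrite le_eqVlt; apply/orP; left; apply/eqP.
transitivity ((lam `^ (- eta) * (lam ^+ m * lam `^ (eta - m%:R))) * (c * mu `^ (eta - m%:R) * e)).
  by rewrite /c1; field; exact: lt0r_neq0.
by rewrite E mul1r.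
Qed.

End Blowup.

(** * Reduction to a normalized counterexample *)

Section Normalization.
Context {R : realType} {d : nat}.
Variables (s : 'I_d -> nat) (m : nat) (a : {ffun 'I_d -> 'I_m.+1} -> R[i]).
Notation pt := 'rV[R]_d.
Implicit Types (U : pt -> pt -> R[i]).

Lemma Gnorm_ge0 (eta : R) U : (0 <= Gnorm s eta U)%E.
Proof. by apply: le_ereal_inf_tmp => _ [M [M0 _] <-]; rewrite lee_fin ltW. Qed.

Lemma Gsemi_ge0 (eta alpha : R) U : (0 <= Gsemi s eta alpha U)%E.
Proof. by apply: le_ereal_inf_tmp => _ [M [M0 _] <-]; rewrite lee_fin ltW. Qed.

Lemma LGsemi_ge (gam : R) U phi x (lam : R) : Bclass s gam phi -> 0 < lam ->
  ((lam `^ (- gam) * cabs (cint (fun y => U x y * LT s a (rescale s phi x lam) y)))%:E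
    <= LGsemi s a gam U)%E.
Proof. by move=> B0 l0; apply: ereal_sup_ubound; eexists; [exists phi, x, lam|]. Qed.

(** Provides a member of the set defining [LGsemi], whose supremum would otherwise be -oo. *)
Lemma Bclass0 (gam : R) : Bclass s gam (fun _ : pt => 0).
Proof.
have t0 := @testfun0 R d.
have L0 l : pdlC l (fun _ : pt => 0 : R[i]) = fun=> 0.
  elim: l => [//|i l IH]; rewrite /= IH; apply/funext => y; rewrite /pdC /pd /=.
  by rewrite derive_cst.
by split => // b _ y; rewrite dmultiE L0 cabs0.
Qed.

Lemma LGsemi_ge0 (gam : R) U : (0 <= LGsemi s a gam U)%E.
Proof.
apply: le_trans (LGsemi_ge U 0 (Bclass0 gam) ltr01).
by rewrite lee_fin mulr_ge0 ?powR_ge0 ?cabs_ge0.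
Qed.

(** N is the germ norm. As it is an infimum, 2N is an admissible constant and N/2 is not, which
    yields the global bound and the nearly extremal pair. *)
Lemma normalize_counterexample (eta alpha c : R) U : 0 < c -> (Gnorm s eta U < +oo)%E ->
  ~ (Gnorm s eta U <= c%:E * (LGsemi s a (eta - m%:R) U + Gsemi s eta alpha U))%E ->
  exists2 N : R, 0 < N & [/\
    forall x y, cabs (U x y) <= 2 * N * adist s x y `^ eta,
    exists x y, N / 2 * adist s x y `^ eta < cabs (U x y),
    forall x y, exists P, isPoly s (Num.truncn eta) P /\ forall z, cabs (U x z - U y z - P z) <=
      N / c * adist s y z `^ alpha * (adist s x y + adist s y z) `^ (eta - alpha) &
    forall phi x (lam : R), Bclass s (eta - m%:R) phi -> 0 < lam ->
      lam `^ (- (eta - m%:R)) * cabs (cint (fun y => U x y * LT s a (rescale s phi x lam) y)) <= N / c].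
Proof.
move=> c0 Goo /negP; rewrite -ltNge => lt.
have Gfin : Gnorm s eta U \is a fin_num by rewrite ge0_fin_numE // Gnorm_ge0.
pose N := fine (Gnorm s eta U).
have GN : Gnorm s eta U = N%:E by rewrite fineK.
have L0 := LGsemi_ge0 (eta - m%:R) U; have S0 := Gsemi_ge0 eta alpha U.
have lt2 : (LGsemi s a (eta - m%:R) U + Gsemi s eta alpha U < (N / c)%:E)%E.
  rewrite mulrC EFinM lte_pdivlMl // -GN; exact: lt.
(* The right-hand side is nonnegative and strictly below N / c. *)
have N0 : 0 < N.
  have : (0 < (N / c)%:E)%E by apply: le_lt_trans lt2; exact: adde_ge0.
  by rewrite lte_fin pmulr_lgt0 // invr_gt0.
have Lc : (LGsemi s a (eta - m%:R) U < (N / c)%:E)%E.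
  by apply: le_lt_trans lt2; rewrite leeDl.
have Sc : (Gsemi s eta alpha U < (N / c)%:E)%E.
  by apply: le_lt_trans lt2; rewrite leeDr.
exists N => //; split.
- have : (Gnorm s eta U < (2 * N)%:E)%E by rewrite GN lte_fin; lra.
  case/ereal_inf_lt => _ [M [M0 hM] <-]; rewrite lte_fin => MN x y.
  by apply: le_trans (hM x y) _; rewrite ler_wpM2r ?powR_ge0 // ltW.
- apply: contrapT => H.
  have : (Gnorm s eta U <= (N / 2)%:E)%E.
    apply: ereal_inf_lbound; exists (N / 2) => //; split; first by rewrite divr_gt0.
    by move=> x y; rewrite leNgt; apply/negP => h; apply: H; exists x, y.
  by rewrite GN lee_fin; lra.
- case/ereal_inf_lt : Sc => _ [M [M0 hM] <-]; rewrite lte_fin => MN x y.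
  have [P [iP hP]] := hM x y; exists P; split => // z.
  apply: le_trans (hP z) _; apply: ler_wpM2r; first exact: powR_ge0.
  by apply: ler_wpM2r; [exact: powR_ge0|exact: ltW].
- move=> phi x lam B0 l0; rewrite -lee_fin; apply: le_trans (ltW Lc); exact: LGsemi_ge.
Qed.

End Normalization.

Unset Implicit Arguments.

Theorem theorem3p1 (R : realType) (d : nat) (s : 'I_d -> nat)
  (hs : forall i, (0 < s i)%N)
  (m : nat) (a : {ffun 'I_d -> 'I_m.+1} -> R[i])
  (hL : elliptic s a)
  (alpha eta : R) (h0 : 0 < alpha) (h1 : alpha < eta) (h2 : eta < m%:R)
  (hanat : forall n : nat, alpha <> n%:R) (henat : forall n : nat, eta <> n%:R) :
  exists C : R, forall U : 'rV[R]_d -> 'rV[R]_d -> R[i],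
    germ U -> (Gnorm s eta U < +oo)%E ->
    (Gnorm s eta U <= C%:E * (LGsemi s a (eta - m%:R) U + Gsemi s eta alpha U))%E.
Proof.
apply: contrapT => H.
have eta0 : 0 < eta by exact: lt_trans h1.
have /choice[D hD] : forall n : nat, exists D : ('rV[R]_d -> 'rV[R]_d -> R[i]) * R * ('rV[R]_d * 'rV[R]_d),
    [/\ germ D.1.1, 0 < D.1.2, D.1.2 / 2 * adist s D.2.1 D.2.2 `^ eta < cabs (D.1.1 D.2.1 D.2.2) & [/\
    forall x y, cabs (D.1.1 x y) <= 2 * D.1.2 * adist s x y `^ eta,
    forall x y, exists P, isPoly s (Num.truncn eta) P /\ forall z, cabs (D.1.1 x z - D.1.1 y z - P z) <=
      D.1.2 / n.+1%:R * adist s y z `^ alpha * (adist s x y + adist s y z) `^ (eta - alpha) &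
    forall phi x (lam : R), Bclass s (eta - m%:R) phi -> 0 < lam ->
      lam `^ (- (eta - m%:R)) * cabs (cint (fun y => D.1.1 x y * LT s a (rescale s phi x lam) y)) <= D.1.2 / n.+1%:R]].
  move=> n; apply: contrapT => K; apply: H; exists n.+1%:R => U gU Uoo.
  apply: contrapT => bad; apply: K.
  have [N N0 [a1 [x [y a2]] a3 a4]] := normalize_counterexample (ltr0Sn R n) Uoo bad.
  by exists (U, N, (x, y)).
pose U n := (D n).1.1; pose N n := (D n).1.2; pose x n := (D n).2.1; pose y n := (D n).2.2.
pose lam n := adist s (x n) (y n).
have N0 n : 0 < N n by have [] := hD n.
(* At distance 0 the upper bound would force the value at the nearly extremal pair to vanish,
   against its strict lower bound. *)
have l0 n : 0 < lam n.
  rewrite lt0r adist_ge0 andbT; apply/eqP => E.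
  have [_ _ lt [bd _ _]] := hD n.
  have := bd (x n) (y n); move: lt; rewrite -/(x n) -/(y n) -/(lam n) E powR0 ?lt0r_neq0 // !mulr0.
  by move=> lt le; have := lt_le_trans lt le; rewrite ltxx.
pose V n z := (lam n `^ (- eta) / N n)%:C%C * U n (x n) (affm (x n) (dil s (lam n)) z).
have hV n : approx_germ s (Num.truncn eta) eta alpha (V n).
  have [gU _ _ [b1 b2 _]] := hD n.
  apply: (@blowup_approx_germ R d s hs (Num.truncn eta) eta alpha (N n) (N n / n.+1%:R) (U n) (x n) (lam n)) => //.
    by rewrite divr_ge0 // ltW.
  by rewrite ler_pdivrMr // ler_peMr ?(ltW (N0 n)) // ler1n.
have hT psi : testfun setT psi -> exists K : R, forall n,
    cabs (cint (fun z => V n z * LT s a psi z)) <= K * n.+1%:R^-1.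
  move=> /(blowup_LT a hs eta)[K hK]; exists K => n.
  have [gU _ _ [_ _ b3]] := hD n.
  by apply: hK => // phi mu B0 m0; exact: b3.
(* Any level up to 1/2 contradicts the lower bound at [z], the rescaled position of [y n]. *)
have [|n hn] := blowup_limit hs hL h0 h1 henat hV hT (e := 4^-1); first by rewrite invr_gt0.
pose z : 'rV[R]_d := affm (invr_affm (x n) (dil s (lam n))) (fun i => (dil s (lam n) i)^-1) (y n).
have zE : affm (x n) (dil s (lam n)) z = y n.
  by apply/rowP => i; rewrite !mxE; field; rewrite lt0r_neq0 // dil_gt0.
have z1 : adist s 0 z = 1.
  have := adist_dil hs (x n) 0 z (l0 n); rewrite affm0 zE -/(lam n) => E.
  by apply: (mulfI (lt0r_neq0 (l0 n))); rewrite mulr1.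
(* A coordinate larger than 1 would alone contribute more than 1 to d(0, z). *)
have zn : `|z| <= 1.
  apply: normrV_le => // i; rewrite leNgt; apply/negP => zi.
  have : adist s 0 z <= 1 by rewrite z1.
  rewrite leNgt => /negP; apply; rewrite /adist (bigD1 i) //= mxE sub0r normrN.
  apply: (@lt_le_trans _ _ (`|z 0 i| `^ (s i)%:R^-1)); last first.
    by rewrite lerDl; apply: sumr_ge0 => j _; exact: powR_ge0.
  apply: (@le_lt_trans _ _ (1 `^ (s i)%:R^-1)); first by rewrite powR1.
  by apply: gt0_ltr_powR; rewrite ?nnegrE ?invr_gt0 ?ltr0n.
have := hn z zn; rewrite /V zE cabsM cabsR gtr0_norm ?divr_gt0 ?powR_gt0 //.
have [_ _ lt _] := hD n; move: lt; rewrite -/(U n) -/(N n) -/(x n) -/(y n) -/(lam n) => lt.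
have c0 : 0 < lam n `^ (- eta) / N n by rewrite divr_gt0 ?powR_gt0.
have := lt; rewrite -(ltr_pM2l c0) => lt2 le.
have : lam n `^ (- eta) / N n * (N n / 2 * lam n `^ eta) = 2^-1.
  have lN : lam n `^ (- eta) * lam n `^ eta = 1.
    by rewrite -powRD ?addNr ?powRr0 // (gt_eqF (l0 n)) implybT.
  transitivity (lam n `^ (- eta) * lam n `^ eta / 2); last by rewrite lN mul1r.
  by field; exact: (lt0r_neq0 (N0 n)).
move=> E; rewrite E in lt2; have := lt_le_trans lt2 le.
lra.
Qed.
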